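(* Let $G$ be a group having a finite-index subgroup $H<G$ and a subnormal series $1=H_n\vartriangleleft H_{n-1}\vartriangleleft\cdots\vartriangleleft H_0=H$ satisfying: (i) every finitely generated subgroup of each quotient $H_i/H_{i+1}$ ($i=0,\dots,n-1$) has a purely positive length function; and (ii) any torsion abelian subgroup in every finitely generated subgroup of each quotient $H_i/H_{i+1}$ ($i=0,\dots,n-1$) is finitely generated. Let $R$ be a finitely generated associative ring with identity, let $m\geq 3$, and let $E_m(R)$ be the elementary subgroup. Suppose that $\Gamma<E_m(R)$ is a finite-index subgroup. Then any group homomorphism $f:\Gamma\to G$ has finite image.
   Context: A function $l:G\to[0,\infty)$ on a group $G$ is a length function if (1) $l(g^n)=|n|\,l(g)$ for all $g\in G$, $n\in\mathbb{Z}$; (2) $l(hgh^{-1})=l(g)$ for all $g,h\in G$; (3) $l(ab)\le l(a)+l(b)$ for all commuting elements $a,b\in G$. It is purely positive if $l(g)>0$ for every infinite-order element $g$. For an associative ring $R$ with identity, $E_m(R)\le \mathrm{GL}_m(R)$ is the subgroup generated by the elementary matrices $e_{ij}(r)$ ($1\le i\ne j\le m$, $r\in R$), where $e_{ij}(r)$ has $1$'s on the diagonal, $r$ in position $(i,j)$ and zeros elsewhere. *)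

(* Defs.v *)
From HB Require Import structures.
From mathcomp Require Import all_boot all_order all_algebra.
From mathcomp Require Import generic_quotient.
From mathcomp Require Import boolp classical_sets functions cardinality reals.

Set Implicit Arguments.
Unset Strict Implicit.
Unset Printing Implicit Defensive.

Import Order.TTheory GRing.Theory Num.Theory.

Local Open Scope quotient_scope.
Local Open Scope group_scope.

(* Subgroups of a possibly infinite group G are the bundled predicates
   [H : groupClosed G]; [subgroup_type H] is H as a group in its own right. *)
Section SubgroupType.
Variables (G : groupType) (H : groupClosed G).

Definition subgroup_type : Type := {x : G | x \in H}.

HB.instance Definition _ := SubChoice.copy subgroup_type {x : G | x \in H}.

Fact subgroup_closed : group_closed H.
Proof. by split=> [|x y Hx Hy]; [exact: gpred1 | exact: gpredF]. Qed.

HB.instance Definition _ :=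
  SubChoice_isSubGroup.Build G (fun x => x \in H) subgroup_type subgroup_closed.

End SubgroupType.

Section Generation.
Variables (G : groupType) (S : set G).

Definition generated : {pred G} := fun x =>
  `[< forall K : groupClosed G, (forall y, S y -> y \in K) -> x \in K >].

Fact generated_mul : mulg_closed generated.
Proof.
move=> x y /asboolP Sx /asboolP Sy; apply/asboolP=> K SK.
by apply: gpredM; [apply: Sx | apply: Sy].
Qed.

Fact generated_one : 1 \in generated.
Proof. by apply/asboolP=> K _; apply: gpred1. Qed.

Fact generated_inv : invg_closed generated.
Proof. by move=> x /asboolP Sx; apply/asboolP=> K SK; rewrite gpredV Sx. Qed.

HB.instance Definition _ := isMulClosed.Build G generated generated_mul.
HB.instance Definition _ := isMul1Closed.Build G generated generated_one.
HB.instance Definition _ := isInvClosed.Build G generated generated_inv.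

End Generation.

Definition finitely_generated (G : groupType) : Prop :=
  exists s : seq G, forall x : G, x \in generated [set` s].

Definition finitely_generated_ring (R : pzRingType) : Prop :=
  exists s : seq R,
    forall S : subringClosed R, {subset s <= S} -> forall x : R, x \in S.

Definition left_coset (G : groupType) (H : groupClosed G) (x : G) : set G :=
  [set x * h | h in [set` H]].

Definition finite_index (G : groupType) (H : groupClosed G) : Prop :=
  finite_set (range (left_coset H)).

Definition infinite_order (G : groupType) (g : G) : Prop :=
  forall n : nat, (0 < n)%N -> g ^+ n <> 1.

Definition torsion (G : groupType) : Prop :=
  forall g : G, ~ infinite_order g.

Definition abelian_group (G : groupType) : Prop :=
  forall x y : G, x * y = y * x.

Definition expgz (G : groupType) (g : G) (n : int) : G :=
  match n with Posz k => g ^+ k | Negz k => g ^- k.+1 end.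

Definition length_function (R : realType) (G : groupType) (l : G -> R) : Prop :=
  [/\ forall g, (0 <= l g)%R,
      forall g (n : int), l (expgz g n) = (`|n|%:~R * l g)%R,
      forall g h, l (h * g * h^-1) = l g &
      forall a b, commute a b -> (l (a * b)%g <= l a + l b)%R].

Definition purely_positive (R : realType) (G : groupType) (l : G -> R) : Prop :=
  forall g, infinite_order g -> (0 < l g)%R.

Section Quotient.
Variables (G : groupType) (N : groupClosed G).

Definition normal_subgroup : Prop := forall x y : G, x \in N -> y * x * y^-1 \in N.

Definition coset_rel : rel G := fun x y => x^-1 * y \in N.

Fact coset_rel_refl : reflexive coset_rel.
Proof. by move=> x; rewrite /coset_rel mulVg gpred1. Qed.

Fact coset_rel_sym : symmetric coset_rel.
Proof.
by move=> x y; rewrite /coset_rel -(gpredV N (x^-1 * y)) invgM invgK.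
Qed.

Fact coset_rel_trans : transitive coset_rel.
Proof.
by move=> y x z xy yz; rewrite /coset_rel -(mulgK y x^-1) -mulgA gpredM.
Qed.

Canonical coset_equiv :=
  EquivRel coset_rel coset_rel_refl coset_rel_sym coset_rel_trans.

Hypothesis nN : normal_subgroup.

Definition quotient_group : Type := let _ := nN in {eq_quot coset_equiv}.

HB.instance Definition _ := Choice.on quotient_group.

Let Q : quotType G := {eq_quot coset_equiv}.
Let pr (x : G) : quotient_group := \pi_Q x.
Let rp (u : quotient_group) : G := repr (u : Q).

Let rpK u : pr (rp u) = u. Proof. exact: reprK. Qed.

Let prP x y : pr x = pr y <-> x^-1 * y \in N.
Proof. by split=> [/eqmodP | H]; [| apply/eqmodP]. Qed.

Let rp_pr x : exists2 h, h \in N & rp (pr x) = x * h.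
Proof.
exists (x^-1 * rp (pr x)); last by rewrite mulVKg.
by apply/prP; rewrite rpK.
Qed.

Definition quotient_mul (u v : quotient_group) : quotient_group :=
  pr (rp u * rp v).
Definition quotient_one : quotient_group := pr 1.
Definition quotient_inv (u : quotient_group) : quotient_group := pr (rp u)^-1.

Let conjN x y : x \in N -> y^-1 * x * y \in N.
Proof. by move=> Nx; have := nN y^-1 Nx; rewrite invgK. Qed.

Let pr_mul x y : quotient_mul (pr x) (pr y) = pr (x * y).
Proof.
have [h Nh eh] := rp_pr x; have [k Nk ek] := rp_pr y.
rewrite /quotient_mul eh ek; apply/esym/prP; rewrite invgM !mulgA mulgVK.
by rewrite gpredM // conjN.
Qed.

Let pr_inv x : quotient_inv (pr x) = pr x^-1.
Proof.
have [h Nh eh] := rp_pr x.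
by apply/prP; rewrite eh invgK; apply: nN.
Qed.

Fact quotient_mulgA : associative quotient_mul.
Proof. by move=> u v w; rewrite -(rpK u) -(rpK v) -(rpK w) !pr_mul mulgA. Qed.
Fact quotient_mul1g : left_id quotient_one quotient_mul.
Proof. by move=> u; rewrite -(rpK u) pr_mul mul1g. Qed.
Fact quotient_mulg1 : right_id quotient_one quotient_mul.
Proof. by move=> u; rewrite -(rpK u) pr_mul mulg1. Qed.
Fact quotient_mulVg : left_inverse quotient_one quotient_inv quotient_mul.
Proof. by move=> u; rewrite -(rpK u) pr_inv pr_mul mulVg. Qed.
Fact quotient_mulgV : right_inverse quotient_one quotient_inv quotient_mul.
Proof. by move=> u; rewrite -(rpK u) pr_inv pr_mul mulgV. Qed.

HB.instance Definition _ := isGroup.Build quotient_group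
  quotient_mulgA quotient_mul1g quotient_mulg1 quotient_mulVg quotient_mulgV.

Definition quotient_map (x : G) : quotient_group := pr x.

Fact quotient_mapM : {morph quotient_map : x y / x * y}.
Proof. by move=> x y; rewrite /quotient_map -pr_mul. Qed.

Fact quotient_mapP x y : quotient_map x = quotient_map y <-> x^-1 * y \in N.
Proof. exact: prP. Qed.

Fact quotient_map_surj u : exists x, quotient_map x = u.
Proof. by exists (rp u); apply: rpK. Qed.

End Quotient.

Section RelativeSubgroup.
Variables (G : groupType) (N K : groupClosed G).

(* The subgroup N of G, intersected with K and seen inside K. *)
Definition inside : {pred subgroup_type K} := fun x => val x \in N.

Fact inside_mul : mulg_closed inside.
Proof. by move=> x y Nx Ny; rewrite unfold_in valM gpredM. Qed.
Fact inside_one : 1 \in inside.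
Proof. by rewrite unfold_in val1 gpred1. Qed.
Fact inside_inv : invg_closed inside.
Proof. by move=> x Nx; rewrite unfold_in gmulfV gpredV. Qed.

HB.instance Definition _ := isMulClosed.Build _ inside inside_mul.
HB.instance Definition _ := isMul1Closed.Build _ inside inside_one.
HB.instance Definition _ := isInvClosed.Build _ inside inside_inv.

Definition normal_in : Prop := {subset N <= K} /\ normal_subgroup inside.

Definition factor_group (nNK : normal_in) : groupType :=
  quotient_group (proj2 nNK).

End RelativeSubgroup.

Section GeneralLinear.
Variables (R : pzRingType) (m : nat).

Definition mutually_inverse (AB : 'M[R]_m * 'M[R]_m) : bool :=
  ((AB.1 *m AB.2 == 1%:M) && (AB.2 *m AB.1 == 1%:M))%R.

(* An invertible matrix is stored with its two-sided inverse, since R need not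
   be commutative; [GLmx] is injective by uniqueness of inverses. *)
Definition GL : Type := {AB : 'M[R]_m * 'M[R]_m | mutually_inverse AB}.

HB.instance Definition _ := SubChoice.copy GL
  {AB : 'M[R]_m * 'M[R]_m | mutually_inverse AB}.

Definition GLmx (g : GL) : 'M[R]_m := (val g).1.
Definition GLinvmx (g : GL) : 'M[R]_m := (val g).2.

Fact GLmxV g : (GLmx g *m GLinvmx g = 1%:M)%R.
Proof. by case/andP: (valP g) => /eqP. Qed.
Fact GLVmx g : (GLinvmx g *m GLmx g = 1%:M)%R.
Proof. by case/andP: (valP g) => _ /eqP. Qed.

Fact GLmx_inj : injective GLmx.
Proof.
move=> g h egh; apply: val_inj.
have eV : GLinvmx g = GLinvmx h.
  by rewrite -[LHS]mulmx1 -(GLmxV h) -egh mulmxA GLVmx mul1mx.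
by rewrite [LHS]surjective_pairing [RHS]surjective_pairing; congr pair.
Qed.

Fact GL_mul_subproof (g h : GL) :
  mutually_inverse (GLmx g *m GLmx h, GLinvmx h *m GLinvmx g)%R.
Proof.
apply/andP; split; apply/eqP=> /=.
  by rewrite -mulmxA (mulmxA (GLmx h)) GLmxV mul1mx GLmxV.
by rewrite -mulmxA (mulmxA (GLinvmx g)) GLVmx mul1mx GLVmx.
Qed.
Definition GL_mul (g h : GL) : GL := Sub _ (GL_mul_subproof g h).

Fact GL_one_subproof : mutually_inverse (1%:M, 1%:M)%R.
Proof. by rewrite /mutually_inverse mul1mx eqxx. Qed.
Definition GL_one : GL := Sub _ GL_one_subproof.

Fact GL_inv_subproof (g : GL) : mutually_inverse (GLinvmx g, GLmx g).
Proof. by rewrite /mutually_inverse GLmxV GLVmx eqxx. Qed.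
Definition GL_inv (g : GL) : GL := Sub _ (GL_inv_subproof g).

Fact GL_mulgA : associative GL_mul.
Proof. by move=> g h k; apply: GLmx_inj; rewrite /GLmx /= mulmxA. Qed.
Fact GL_mul1g : left_id GL_one GL_mul.
Proof. by move=> g; apply: GLmx_inj; rewrite /GLmx /= mul1mx. Qed.
Fact GL_mulg1 : right_id GL_one GL_mul.
Proof. by move=> g; apply: GLmx_inj; rewrite /GLmx /= mulmx1. Qed.
Fact GL_mulVg : left_inverse GL_one GL_inv GL_mul.
Proof. by move=> g; apply: GLmx_inj; apply: GLVmx. Qed.
Fact GL_mulgV : right_inverse GL_one GL_inv GL_mul.
Proof. by move=> g; apply: GLmx_inj; apply: GLmxV. Qed.

HB.instance Definition _ :=
  isGroup.Build GL GL_mulgA GL_mul1g GL_mulg1 GL_mulVg GL_mulgV.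

Definition elementary_mx (i j : 'I_m) (r : R) : 'M[R]_m :=
  (1%:M + r *: delta_mx i j)%R.

Definition elementary : set GL :=
  [set g | exists i j (r : R), i != j /\ GLmx g = elementary_mx i j r].

Fact elementary_mxK i j r : i != j ->
  (elementary_mx i j r *m elementary_mx i j (- r) = 1%:M)%R.
Proof.
move=> ij; rewrite /elementary_mx mulmxDl mul1mx mulmxDr mulmx1.
rewrite -scalemxAl (_ : (delta_mx i j *m (- r *: delta_mx i j) = 0)%R).
  by rewrite scaler0 addr0 scaleNr addrNK.
apply/matrixP=> a b; rewrite !mxE big1 // => k _; rewrite !mxE.
by case: (k =P j) => [->|]; rewrite ?andbF ?mul0r // (eq_sym j) (negPf ij) !mulr0.
Qed.

Fact elementary_mx_GL i j r : i != j ->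
  exists2 g : GL, elementary g & GLmx g = elementary_mx i j r.
Proof.
move=> ij.
have P : mutually_inverse (elementary_mx i j r, elementary_mx i j (- r)).
  rewrite /mutually_inverse elementary_mxK //=.
  by rewrite -{2}[r]opprK elementary_mxK // eqxx.
by exists (Sub _ P) => //; exists i, j, r.
Qed.

Definition elementary_subgroup : groupClosed GL := generated elementary.

Definition elementary_group : groupType := subgroup_type elementary_subgroup.

End GeneralLinear.

(* Main.v *)
Require Import Defs.
From HB Require Import structures.
From mathcomp Require Import all_boot all_order all_algebra.
From mathcomp Require Import generic_quotient.
From mathcomp Require Import boolp classical_sets functions cardinality reals.

(** The theorem follows the filtration of [G] downwards: a finite-index subgroup
    of [E_m(R)] maps into [H], and if a finite-index subgroup [D] maps into
    [H_i], then a smaller finite-index subgroup maps into [H_(i+1)].  At the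
    bottom the image is trivial, so [f] has finite image.  Everything therefore
    rests on [kernel_finite_index]: a homomorphism [phi] from a finite-index
    subgroup [D] of [E_m(R)] to a group [Q] satisfying the two hypotheses has a
    kernel of finite index.

    Why that holds.  Every root subgroup element has a power in [D], and
    [[x_ik(a), x_kj(b)] = x_ij(ab)] exhibits a power of [x_ij(r)] in [D] as a
    central commutator of a Heisenberg group inside [D].  In such a group
    [[a, b^n] = [a, b]^n] while [l [a, b^n] <= 2 l(a)], so [l [a, b] = 0]
    ([length_heisenberg]), and pure positivity makes [phi (x_ij(r))] torsion.
    The images of the root subgroups are then torsion abelian subgroups of a
    finitely generated group, hence finite: [phi] is trivial on [x_ij(r)] for
    [r] in a finite-index subgroup of [R].  Applied to all conjugates of the
    root subgroups, this shows that the largest normal subgroup [M] of [E_m(R)]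
    inside the kernel contains [x_ij(J)] for a two-sided ideal [J] of finite
    index.

    Thus [E_m(R)/M] is generated by elements [x_ij(a)], [a] in the finite ring
    [A = R/J], satisfying the Steinberg relations, and it remains to see that
    such a group [S] is finite ([steinberg_finite]).  A finite ring has stable
    rank one ([finite_stable_rank1]).  The subgroup generated by [X_ij] and
    [X_ji] acts on the other root subgroups through 2x2 matrices, so stable
    rank one puts each of its elements in [T X_ij X_ji X_ij], where [T] is the
    set of elements acting diagonally.  Since [T] normalizes every root
    subgroup, moving factors across gives [S = T U- U U-]
    ([bounded_generation]) with [U] and [U-] finite; elements of [T] with the
    same diagonal differ by a central element, so the centre of [S] has finite
    index.  As [S] is perfect, the transfer into the centre is trivial, the
    centre has finite exponent, and being finitely generated it is finite
    ([finite_perfect]).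

    Finiteness of index is handled by colourings: a relation has finitely many
    classes when some map to a finite type identifies only related points.
    This form is stable under intersections, pull-backs and refinements, and it
    applies to groups and to additive groups alike. *)

Set Implicit Arguments.
Unset Strict Implicit.
Unset Printing Implicit Defensive.

Import Order.TTheory GRing.Theory Num.Theory.

(** * Finite rings have stable rank one *)

Definition finite_type (T : eqType) : Prop := exists s : seq T, forall x, x \in s.

Lemma sequence_repeats (T : eqType) (c : nat -> T) : finite_type T ->
  exists i k, c i = c (i + k.+1)%N.
Proof.
move=> [s sP]; apply: contrapT => noc.
have inj : injective c.
  move=> i j cij; case: (ltngtP i j) => // lt; case: noc.
    by exists i, (j - i).-1; rewrite prednK ?subn_gt0 // subnKC // ltnW.
  by exists j, (i - j).-1; rewrite prednK ?subn_gt0 // subnKC // ltnW.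
have : uniq (map c (iota 0 (size s).+1)) by rewrite map_inj_uniq ?iota_uniq.
move/(@uniq_leq_size _ _ s); rewrite size_map size_iota ltnn.
by move=> /(_ (fun x _ => sP x)).
Qed.

Section FiniteRing.
Local Open Scope ring_scope.
Variables (A : pzRingType) (finA : finite_type A).

Lemma idempotent_power (a : A) : exists n, a ^+ n.+1 * a ^+ n.+1 = a ^+ n.+1.
Proof.
have [i [k ek]] := sequence_repeats (GRing.exp a) finA.
have step j : a ^+ (i + j * k.+1) = a ^+ i.
  by elim: j => [|j IHj]; rewrite ?addn0 // mulSn addnA exprD -ek -exprD.
exists (i * k.+1 + k)%N; rewrite -addnS -mulSnr -exprD.
set n := (_.+1 * _)%N; have le_in : (i <= n)%N.
  by rewrite /n -{1}(muln1 i) leq_mul // ltnW.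
have -> : (n + n = i + n + (n - i))%N by rewrite -addnA addnCA subnKC.
by rewrite exprD step -exprD subnKC.
Qed.

(** Powers of [a] repeat, and [u] cancels powers of [a] on the left, so [a] has
    finite multiplicative order. *)
Lemma left_inverse_unit (u a : A) : u * a = 1 -> a * u = 1.
Proof.
move=> ua; have [i [k ek]] := sequence_repeats (GRing.exp a) finA.
have cancel j : u ^+ j * a ^+ j = 1.
  elim: j => [|j IHj]; first by rewrite mulr1.
  by rewrite exprSr exprS mulrA -(mulrA _ u) ua mulr1.
have ak : a ^+ k.+1 = 1.
  by rewrite -[LHS]mul1r -(cancel i) -mulrA -exprD -ek.
have -> : u = a ^+ k by rewrite -[RHS]mul1r -ua -mulrA -exprS ak mulr1.
by rewrite -exprS.
Qed.

(** The Jacobson radical; quantifying over both multipliers makes it visibly a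
    two-sided ideal. *)
Definition radical (p : A) : Prop := forall r s, exists u, u * (1 - r * p * s) = 1.

Lemma radicalD p q : radical p -> radical q -> radical (p + q).
Proof.
move=> Np Nq r s; have [u up] := Np r s.
have [v vq] := Nq (u * r) s; exists (v * u).
have -> : 1 - r * (p + q) * s = (1 - r * p * s) * (1 - u * r * q * s).
  rewrite [RHS]mulrBr mulr1 -(mulrA u) -(mulrA u) (mulrA _ u) (left_inverse_unit up).
  by rewrite mul1r mulrDr mulrDl opprD addrA.
by rewrite mulrA -(mulrA v) up mulr1.
Qed.

Lemma radicalM p r s : radical p -> radical (r * p * s).
Proof. by move=> Np r' s'; have := Np (r' * r) (s * s'); rewrite !mulrA. Qed.

Lemma radical0 : radical 0.
Proof. by move=> r s; exists 1; rewrite mulr0 mul0r subr0 mulr1. Qed.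

Lemma radical_idempotent (f : A) : f * f = f -> radical f -> f = 0.
Proof.
move=> ff /(_ 1 1) [u]; rewrite mul1r mulr1 => uf.
by rewrite -[f]mul1r -uf -mulrA mulrBl mul1r ff subrr mulr0.
Qed.

Lemma nilpotent_unit (z : A) n : z ^+ n = 0 -> exists u, u * (1 - z) = 1.
Proof.
move=> zn; have := subrX1 z n; rewrite zn sub0r => h.
exists (\sum_(i < n) z ^+ i); apply: left_inverse_unit.
by apply: oppr_inj; rewrite h -mulNr opprB.
Qed.

Section RelativeInverse.
Variables (a x : A).
Hypotheses (axa : a * x * a = a) (xax : x * a * x = x).
Let f := 1 - a * x.
Let f' := 1 - x * a.

Let fa : f * a = 0. Proof. by rewrite mulrBl mul1r axa subrr. Qed.
Let xf : x * f = 0. Proof. by rewrite mulrBr mulr1 mulrA xax subrr. Qed.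
Let af' : a * f' = 0. Proof. by rewrite mulrBr mulr1 mulrA axa subrr. Qed.
Let f'x : f' * x = 0. Proof. by rewrite mulrBl mul1r xax subrr. Qed.
Let ff : f * f = f. Proof. by rewrite {2}/f mulrBr mulr1 mulrA fa mul0r subr0. Qed.
Let f'f' : f' * f' = f'.
Proof. by rewrite {2}/f' mulrBr mulr1 mulrA f'x mul0r subr0. Qed.

(** If the corner [f A f'] lay in the radical, right multiplication by [x] would
    be injective modulo the radical on [f A]; as the powers of [x] repeat and
    [x f = 0], this would put the idempotent [f] itself in the radical. *)
Lemma corner_not_radical : f != 0 -> exists2 p, f * p * f' = p & ~ radical p.
Proof.
move=> /eqP f0; apply: contrapT => none; apply: f0.
have corner y : radical (f * y * f').
  apply: contrapT => nr; apply: none; exists (f * y * f') => //.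
  by rewrite !mulrA ff -(mulrA _ f') f'f'.
have lift y : radical (f * y * x) -> radical (f * y).
  move=> Ny; have -> : f * y = 1 * (f * y * x) * a + f * y * f'.
    by rewrite mul1r mulrBr mulr1 -!mulrA addrCA subrr addr0.
  by apply: radicalD; [apply: radicalM | apply: corner].
have lifts i y : radical (f * y * x ^+ i) -> radical (f * y).
  elim: i y => [|i IHi] y; first by rewrite mulr1.
  by rewrite exprS mulrA -(mulrA f) => /IHi; rewrite mulrA; apply: lift.
have [i [k ek]] := sequence_repeats (GRing.exp x) finA.
have /(radicalM 1 (- f)) : radical (f * (x ^+ k.+1 - 1)).
  apply: (@lifts i); rewrite -mulrA (mulrBl (x ^+ i)) mul1r -exprD addnC -ek subrr mulr0.
  exact: radical0.
rewrite mul1r mulrN -mulrA (mulrBl f) mul1r exprSr -mulrA xf mulr0 sub0r mulrN opprK.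
by rewrite ff; apply: radical_idempotent.
Qed.

(** [a] maps [x A] isomorphically onto [a A], the complements being cut out by
    [f'] and [f].  An element [p] of [f A f'] outside the radical has, for a
    suitable [q], a nonzero idempotent [e] among the powers of [p q]; adding
    [e p] to [a] extends the isomorphism by the summand [e A] of [f A]. *)
Lemma enlarge_relative_inverse : f != 0 -> exists a' x' e : A,
  [/\ a' * x' * a' = a', x' * a' * x' = x', e != 0,
      a' - a = f * (a' - a) & [/\ 1 - a' * x' = f - e, f * e = e, e * e = e & e * f = e]].
Proof.
move=> /corner_not_radical [p fpf' Np].
have fp : f * p = p by rewrite -fpf' !mulrA ff.
have pf' : p * f' = p by rewrite -fpf' -(mulrA _ f') f'f'.
have [r [s nu]] : exists r s, ~ exists u, u * (1 - r * p * s) = 1.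
  apply: contrapT => no; apply: Np => r s; apply: contrapT => no'.
  by apply: no; exists r, s.
have [q qE] : exists q, q = f' * (s * r) * f by eexists.
(* Relates powers of the witness [r p s] that [1 - r p s] is not invertible to
   powers of [p q], so that [e = 0] would make [r p s] nilpotent. *)
have pq_pow l : (r * p * s) ^+ l.+1 = r * (p * q) ^+ l * p * s.
  elim: l => [|l IHl]; first by rewrite mulr1.
  rewrite exprS IHl exprS.
  have fl : f * ((p * q) ^+ l * p) = (p * q) ^+ l * p.
    by case: l {IHl} => [|l]; rewrite ?expr0 ?mul1r ?exprS ?mulrA fp.
  move: ((p * q) ^+ l) fl => w fl.
  have fls : f * (w * (p * s)) = w * (p * s) by rewrite !mulrA -(mulrA f) fl.
  by rewrite -!mulrA qE -!mulrA fls (mulrA p f') pf'.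
have [n en] := idempotent_power (p * q).
set e := _ ^+ n.+1 in en *.
have e0 : e != 0.
  apply/eqP=> e0; apply: nu; apply: (@nilpotent_unit _ n.+2).
  by rewrite pq_pow -[_ ^+ _]/e e0 mulr0 !mul0r.
have [q' q'E] : exists q', q' = q * (p * q) ^+ n by eexists.
have pq' : p * q' = e by rewrite q'E mulrA -exprS.
have fe : f * e = e by rewrite -pq' mulrA fp.
have ef : e * f = e.
  by rewrite /e exprSr qE -!mulrA ff.
have f'q' : f' * q' = q' by rewrite q'E qE !mulrA f'f'.
have aq' : a * q' = 0 by rewrite -f'q' mulrA af' mul0r.
have px : p * x = 0 by rewrite -pf' -mulrA f'x mulr0.
have ea : e * a = 0 by rewrite -ef -mulrA fa mulr0.
have xe : x * e = 0 by rewrite -fe mulrA xf mul0r.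
have ax' : (a + e * p) * (x + q' * e) = a * x + e.
  rewrite mulrDr !mulrDl -(mulrA e p x) px mulr0 addr0 (mulrA a q') aq' mul0r.
  by rewrite add0r -!mulrA (mulrA p) pq' en en.
exists (a + e * p), (x + q' * e), e; split => //.
- rewrite ax' mulrDl !mulrDr axa ea add0r (mulrA e e) en.
  by rewrite -fe mulrA (mulrA _ f) [a * x * f]mulrBr mulr1 mulrA axa subrr !mul0r addr0.
- rewrite -mulrA ax' mulrDl !mulrDr (mulrA x a) xax xe addr0 -(mulrA q' e e) en.
  rewrite -(mulrA q' e) (mulrA e a) ea mul0r mulr0 add0r //.
- by rewrite addrC addKr mulrA fe.
- by split=> //; rewrite ax' opprD addrA.
Qed.

End RelativeInverse.

Lemma count_ltn (T : eqType) (p q : pred T) s y : subpred p q -> y \in s ->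
  q y -> ~~ p y -> (count p s < count q s)%N.
Proof.
move=> pq + qy npy; elim: s => //= z s IHs; rewrite inE => /orP[/eqP<-|/IHs lt].
  by rewrite qy (negPf npy) add0n add1n ltnS sub_count.
rewrite -addnS leq_add //; case: (boolP (p z)) => // /pq -> //.
Qed.

(** Start from an element [a] of [s + r A] with a relative inverse [x] and apply
    [enlarge_relative_inverse] repeatedly: it changes [a] only by elements of
    [(1 - a x) A], a right ideal inside [r A].  The number of points fixed
    by left multiplication by [1 - a x] drops each time, so the process ends with
    [a x = 1]. *)
Lemma finite_stable_rank1 (r s q u : A) : r * q + s * u = 1 ->
  exists t v, v * (s + r * t) = 1 /\ (s + r * t) * v = 1.
Proof.
move=> rqsu; have [l lP] := finA.
pose fixed (f y : A) := f * y == y.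
suff main (N : nat) : forall a x : A, (count (fixed (1 - a * x)%R) l < N)%N ->
    a * x * a = a -> x * a * x = x -> (exists t, 1 - a * x = r * t) ->
    (exists t, a = s + r * t) -> exists t v, v * (s + r * t) = 1 /\ (s + r * t) * v = 1.
  (* Start: with [e] an idempotent power of [s u], [e s] has a relative inverse
     and [1 - e] is a multiple of [1 - s u = r q]. *)
  have [n en] := idempotent_power (s * u).
  set e := _ ^+ n.+1 in en.
  have es : (s * u) * (s * u) ^+ n = e by rewrite -exprS.
  have ax : e * s * (u * (s * u) ^+ n * e) = e.
    by rewrite -!mulrA (mulrA u) (mulrA s) (mulrA s) es !en.
  have [t et] : exists t, 1 - e = r * t.
    exists (q * (\sum_(i < n.+1) (s * u) ^+ i)).
    rewrite mulrA -[r * q](addrK (s * u)) rqsu.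
    by apply: oppr_inj; rewrite opprB subrX1 -mulNr opprB.
  apply: (main _ (e * s) (u * (s * u) ^+ n * e) (leqnn _)).
  - by rewrite ax mulrA en.
  - by rewrite -mulrA ax -mulrA en.
  - by exists t; rewrite ax.
  - exists (- t * s); rewrite mulrA mulrN -et mulNr mulrBl mul1r opprB.
    by rewrite addrCA subrr addr0.
elim: N => // N IHN a x ltN axa xax [t et] [w ew].
have [f0|fn0] := eqVneq (1 - a * x) 0.
  exists w, x; rewrite -ew; have ax : a * x = 1 by apply/esym/subr0_eq.
  by split=> //; apply: left_inverse_unit.
have [a' [x' [e [axa' xax' e0 a'a [ef fe ee ef']]]]] :=
  enlarge_relative_inverse axa xax fn0.
apply: (IHN a' x') => //.
- rewrite -ltnS (leq_trans _ ltN) // ltnS ef.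
  apply: (@count_ltn _ _ _ _ e) => //; last 2 first.
  + by rewrite /fixed fe.
  + by rewrite /fixed mulrBl fe ee subrr eq_sym.
  move=> y /eqP <-; rewrite /fixed mulrA mulrBr fe.
  have -> // : (1 - a * x) * (1 - a * x) = 1 - a * x.
  by rewrite mulrBr mulr1 (mulrA _ a) mulrBl mul1r axa subrr mul0r subr0.
- by exists (t * (1 - e)); rewrite mulrA -et ef mulrBr mulr1 fe.
- exists (w + t * (a' - a)); rewrite mulrDr addrA -ew mulrA -et -a'a.
  by rewrite addrC addrNK.
Qed.

End FiniteRing.

Local Open Scope group_scope.

(** * Generated subgroups *)

Section GeneratedInduction.
Variables (G : groupType) (P : G -> Prop).

(** The [g] whose right translations preserve [P] form a subgroup, whether or not
    [P] itself does; this is what turns the definition of [generated] into an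
    induction on words. *)
Definition translation_stable : {pred G} := fun g =>
  `[< forall h, P h -> P (h * g) /\ P (h * g^-1) >].

Fact translation_stable_mul : mulg_closed translation_stable.
Proof.
move=> x y /asboolP Px /asboolP Py; apply/asboolP=> h Ph; rewrite invgM !mulgA.
by split; [apply: (Py _ _).1; apply: (Px _ _).1 | apply: (Px _ _).2; apply: (Py _ _).2].
Qed.
Fact translation_stable_one : 1 \in translation_stable.
Proof. by apply/asboolP=> h Ph; rewrite invg1 mulg1. Qed.
Fact translation_stable_inv : invg_closed translation_stable.
Proof.
by move=> x /asboolP Px; apply/asboolP=> h /Px[]; rewrite invgK.
Qed.
HB.instance Definition _ := isMulClosed.Build G _ translation_stable_mul.
HB.instance Definition _ := isMul1Closed.Build G _ translation_stable_one.
HB.instance Definition _ := isInvClosed.Build G _ translation_stable_inv.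

Lemma generated_ind (X : set G) : P 1 -> (forall g x, P g -> X x -> P (g * x)) ->
  (forall g x, P g -> X x -> P (g * x^-1)) -> forall g, g \in generated X -> P g.
Proof.
move=> P1 PX PXV g /asboolP/(_ translation_stable) K.
have /asboolP/(_ 1 P1) : g \in translation_stable.
  by apply: K => y Xy; apply/asboolP=> h Ph; split; [apply: PX | apply: PXV].
by rewrite mul1g => -[].
Qed.

End GeneratedInduction.

Section GeneratedTheory.
Variable G : groupType.
Implicit Types (X : set G) (N : groupClosed G).

Lemma mem_generated X x : X x -> x \in generated X.
Proof. by move=> Xx; apply/asboolP=> K; apply. Qed.

Lemma generated_sub X N : (forall x, X x -> x \in N) -> {subset generated X <= N}.
Proof. by move=> XN g /asboolP; apply. Qed.

Lemma generated_conj X N g : (forall x, X x -> x ^ g \in N) ->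
  forall y, y \in generated X -> y ^ g \in N.
Proof.
move=> XN; apply: generated_ind => [|y x Ny /XN Nx|y x Ny /XN Nx].
- by rewrite conj1g gpred1.
- by rewrite conjMg gpredM.
- by rewrite conjMg conjVg gpredF.
Qed.

Definition central (z : G) : Prop := forall y, commute z y.

Lemma generated_central X z : (forall g, g \in generated X) ->
  (forall x, X x -> commute z x) -> central z.
Proof.
move=> genX zX y; have := genX y; elim/generated_ind: y / => [|y x zy /zX|y x zy /zX].
- exact: commute1.
- exact: commuteM.
- by move=> zx; apply: commuteM => //; apply: commuteV.
Qed.

End GeneratedTheory.

(** * Steinberg relations and rank-one subgroups *)

Record steinberg (A : pzRingType) (S : groupType) (m : nat)
    (x : 'I_m -> 'I_m -> A -> S) : Prop := Steinberg {
  st_add : forall i j a b, i != j -> x i j (a + b)%R = x i j a * x i j b;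
  st_commute : forall i j k l a b, i != j -> k != l -> j != k -> i != l ->
    commute (x i j a) (x k l b);
  st_comm : forall i j k a b, i != j -> j != k -> i != k ->
    [~ x i j a, x j k b] = x i k (a * b)%R }.

Lemma third_index m (i j : 'I_m) : 2 < m -> exists k : 'I_m, k != i /\ k != j.
Proof.
move=> m3; suff [k kij] : exists k, k \notin [set i; j]%SET.
  by exists k; move: kij; rewrite !inE negb_or => /andP[].
apply: contrapT => no; have : #|'I_m| <= #|[set i; j]%SET|.
  apply: subset_leq_card; apply/fintype.subsetP=> k _.
  by apply: contrapT => /negP kij; apply: no; exists k.
by rewrite card_ord cards2 leqNgt (leq_ltn_trans _ m3) //; case: eqP.
Qed.

Section SteinbergTheory.
Variables (A : pzRingType) (S : groupType) (m : nat) (x : 'I_m -> 'I_m -> A -> S).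
Hypotheses (m3 : 2 < m) (xS : steinberg x).
Implicit Types (i j k l : 'I_m) (a b c : A) (g : S).

Lemma st_zero i j : i != j -> x i j 0%R = 1.
Proof.
by move=> ij; apply: (mulgI (x i j 0%R)); rewrite -(st_add xS) // addr0 mulg1.
Qed.

Lemma st_opp i j a : i != j -> x i j (- a)%R = (x i j a)^-1.
Proof.
by move=> ij; apply/esym/mulg1_eq; rewrite -(st_add xS) // subrr st_zero.
Qed.

Lemma st_conj_commute i j k l a b : i != j -> k != l -> j != k -> i != l ->
  x i j a ^ x k l b = x i j a.
Proof.
move=> ij kl jk il; rewrite conjgE (st_commute xS a b ij kl jk il) mulgA mulVg.
exact: mul1g.
Qed.

Lemma st_conj_right i j k a b : i != j -> j != k -> i != k ->
  x i j a ^ x j k b = x i j a * x i k (a * b)%R.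
Proof. by move=> ij jk ik; rewrite -(st_comm xS a b ij jk ik) commgEl mulVKg. Qed.

Lemma st_conj_left i j k a b : i != j -> j != k -> i != k ->
  x j k b ^ x i j a = x j k b * x i k (- (a * b))%R.
Proof.
by move=> ij jk ik; rewrite st_opp // -(st_comm xS a b ij jk ik) invgR commgEl mulVKg.
Qed.

(** The conjugation action of a diagonal matrix with entries [d], whose inverse
    has entries [d']. *)
Definition acts_diagonally g : Prop := exists d d' : 'I_m -> A,
  (forall i, d i * d' i = 1 /\ d' i * d i = 1)%R /\
  (forall i j a, i != j -> x i j a ^ g = x i j (d' i * a * d j)%R).

Lemma acts_diagonallyM g h : acts_diagonally g -> acts_diagonally h -> acts_diagonally (g * h).
Proof.
move=> [d [d' [dd dP]]] [e [e' [ee eP]]].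
exists (fun i => d i * e i)%R, (fun i => e' i * d' i)%R; split=> [i|i j a ij].
  have [di di'] := dd i; have [ei ei'] := ee i.
  by rewrite mulrA -(mulrA _ (e i)) ei mulr1 di mulrA -(mulrA _ (d' i)) di' mulr1.
by rewrite conjgM dP // eP // !mulrA.
Qed.

Lemma acts_diagonally1 : acts_diagonally 1.
Proof.
exists (fun=> 1%R), (fun=> 1%R); split=> [i|i j a ij]; first by rewrite mulr1.
by rewrite conjg1 mul1r mulr1.
Qed.

(** [g] acts on the row vectors [x_ki(a) x_kj(b)] and on the column vectors
    [x_ik(a) x_jk(b)] as the 2x2 matrix with rows [(p, q)] and [(r, s)] and
    its right inverse with rows [(p', q')] and [(r', s')].  Recording the action instead
    of an actual matrix avoids asking that [x] be injective. *)
Definition pair_action i j g (p q r s p' q' r' s' : A) : Prop :=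
  [/\ [/\ p * p' + q * r' = 1, p * q' + q * s' = 0,
          r * p' + s * r' = 0 & r * q' + s * s' = 1]%R,
      forall k a, k != i -> k != j ->
        [/\ x k i a ^ g = x k i (a * p)%R * x k j (a * q)%R,
            x k j a ^ g = x k i (a * r)%R * x k j (a * s)%R,
            x i k a ^ g = x i k (p' * a)%R * x j k (r' * a)%R &
            x j k a ^ g = x i k (q' * a)%R * x j k (s' * a)%R] &
      forall k l a, k != l -> k != i -> k != j -> l != i -> l != j ->
        x k l a ^ g = x k l a].

Lemma pair_action_swap i j g p q r s p' q' r' s' : i != j ->
  pair_action i j g p q r s p' q' r' s' -> pair_action j i g s r q p s' r' q' p'.
Proof.
move=> ij [[e1 e2 e3 e4] act fix_]; split=> [|k a kj ki|k l a kl *]; last exact: fix_.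
  by rewrite addrC e4 addrC e3 addrC e2 addrC e1.
have [-> -> -> ->] := act k a ki kj.
split; apply: (st_commute xS); rewrite // eq_sym //.
Qed.

Lemma pair_action_mul i j g p q r s p' q' r' s' t : i != j ->
  pair_action i j g p q r s p' q' r' s' ->
  pair_action i j (g * x i j t) p (q + p * t)%R r (s + r * t)%R
    (p' - t * r')%R (q' - t * s')%R r' s'.
Proof.
move=> ij [[e1 e2 e3 e4] act fix_]; split=> [|k a ki kj|k l a kl ki kj li lj].
- rewrite !mulrBr !mulrDl !mulrA; split.
  + by rewrite addrACA addNr addr0.
  + by rewrite addrACA addNr addr0.
  + by rewrite addrACA addNr addr0.
  + by rewrite addrACA addNr addr0.
- have [h1 h2 h3 h4] := act k a ki kj; have ji : j != i by rewrite eq_sym.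
  have ik : i != k by rewrite eq_sym.
  have jk : j != k by rewrite eq_sym.
  rewrite !conjgM h1 h2 h3 h4 !conjMg; split.
  + rewrite st_conj_right // st_conj_commute // mulrDr mulrA addrC (st_add xS) //.
    by rewrite mulgA.
  + rewrite st_conj_right // st_conj_commute // mulrDr mulrA addrC (st_add xS) //.
    by rewrite mulgA.
  + rewrite st_conj_commute // st_conj_left // mulrBl (st_add xS) // -mulrA -mulgA.
    by congr (_ * _); apply: (st_commute xS).
  + rewrite st_conj_commute // st_conj_left // mulrBl (st_add xS) // -mulrA -mulgA.
    by congr (_ * _); apply: (st_commute xS).
- by rewrite conjgM fix_ // st_conj_commute // eq_sym.
Qed.

Definition root_pair i j : set S :=
  [set g | exists a, g = x i j a \/ g = x j i a].

Lemma pair_action_exists i j g : i != j -> g \in generated (root_pair i j) ->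
  exists p q r s p' q' r' s', pair_action i j g p q r s p' q' r' s'.
Proof.
move=> ij; have ji : j != i by rewrite eq_sym.
pose P g := exists p q r s p' q' r' s', pair_action i j g p q r s p' q' r' s'.
have step h y : P h -> root_pair i j y -> P (h * y).
  move=> [p [q [r [s [p' [q' [r' [s' Ph]]]]]]]] [a [->|->]].
    by do 8!eexists; apply: pair_action_mul Ph.
  do 8!eexists.
    exact: (pair_action_swap ji (pair_action_mul a ji (pair_action_swap ij Ph))).
elim/generated_ind => // [|h y Ph [a hy]].
  exists 1%R, 0%R, 0%R, 1%R, 1%R, 0%R, 0%R, 1%R.
  split=> [|k a ki kj|k l a kl _ _ _ _]; last exact: conjg1.
    by rewrite !mulr0 !mul0r !mulr1 !addr0 add0r.
  have [ik jk] : i != k /\ j != k by rewrite ![_ == k]eq_sym.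
  by rewrite !conjg1 !mulr0 !mul0r !mulr1 !mul1r !st_zero // !mul1g !mulg1.
apply: step => //; exists (- a)%R.
by case: hy => ->; [left | right]; rewrite st_opp.
Qed.

(** The roots [(i, j)] and [(j, i)] themselves are reached through a third index:
    [x_ij(a) = [x_ik(a), x_kj(1)]]. *)
Lemma pair_action_diagonal i j g p s p' s' : i != j ->
  (p * p' = 1)%R -> (p' * p = 1)%R -> (s * s' = 1)%R -> (s' * s = 1)%R ->
  pair_action i j g p 0%R 0%R s p' 0%R 0%R s' -> acts_diagonally g.
Proof.
move=> ij pp' p'p ss' s's act; have ji : j != i by rewrite eq_sym.
exists (fun k => if k == i then p else if k == j then s else 1%R).
exists (fun k => if k == i then p' else if k == j then s' else 1%R).
split=> [k|]; first by case: eqP => // _; case: eqP => // _; rewrite mulr1.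
have pairE i' j' p1 s1 p1' s1' a : i' != j' ->
    pair_action i' j' g p1 0%R 0%R s1 p1' 0%R 0%R s1' ->
    x i' j' a ^ g = x i' j' (p1' * a * s1)%R.
  move=> ij' [_ act' _]; have [k [ki kj]] := third_index i' j' m3.
  have ik : i' != k by rewrite eq_sym.
  have jk : j' != k by rewrite eq_sym.
  rewrite -[a in LHS]mulr1 -(st_comm xS a 1%R ik kj ij') conjRg.
  have [_ e2 _ _] := act' k 1%R ki kj; have [_ _ e3 _] := act' k a ki kj.
  rewrite e2 e3 !mulr0 !mul0r !st_zero // mulg1 mul1g mul1r.
  by rewrite (st_comm xS).
have swapped := pair_action_swap ij act.
have [_ act1 fix_] := act; move=> k l a kl.
have [ki|ki] := eqVneq k i; have [lj|lj] := eqVneq l j.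
- by rewrite ki lj (negPf ji); exact: (pairE i j p s p' s' a ij act).
- move: kl; rewrite ki => il; rewrite eq_sym (negPf il).
  have li : l != i by rewrite eq_sym.
  by have [_ _ -> _] := act1 l a li lj; rewrite mul0r st_zero 1?eq_sym // mulr1 mulg1.
- have [kj|kj] := eqVneq k j; first by rewrite kj lj eqxx in kl.
  rewrite lj (negPf ji); have [_ -> _ _] := act1 k a ki kj.
  by rewrite mulr0 st_zero // mul1g mul1r.
have [kj|kj] := eqVneq k j; have [li|li] := eqVneq l i.
- by rewrite kj li; exact: (pairE j i s p s' p' a ji swapped).
- have [_ _ _] := act1 l a li lj; rewrite kj => ->.
  by rewrite mul0r st_zero 1?eq_sym // mulr1 mul1g.
- rewrite li; have [-> _ _ _] := act1 k a ki kj.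
  by rewrite mulr0 st_zero // mulg1 mul1r.
- by rewrite fix_ // mul1r mulr1.
Qed.

Hypothesis finA : finite_type A.

(** Gaussian elimination on the 2x2 matrix of [g].  Its second row is unimodular,
    so stable rank one makes the lower right entry a unit after one column
    operation; two more make the matrix diagonal. *)
Lemma pair_decomposition i j g : i != j -> g \in generated (root_pair i j) ->
  exists t a b c, acts_diagonally t /\ g = t * x i j a * x j i b * x i j c.
Proof.
move=> ij Lg; have ji : j != i by rewrite eq_sym.
have [p [q [r [s [p' [q' [r' [s' act]]]]]]]] := pair_action_exists ij Lg.
have [[_ _ _ rqss] _ _] := act.
have [a [v [vs sv]]] := finite_stable_rank1 finA rqss.
have := pair_action_mul a ij act.
move: (s + r * a)%R (q + p * a)%R (p' - a * r')%R (q' - a * s')%R vs sv.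
move=> {act rqss q p' q' s} s q p' q' vs sv /(pair_action_swap ij).
move/(pair_action_mul (- (v * r))%R ji); rewrite mulrN mulrA sv mul1r subrr.
move/(pair_action_swap ji); set c := (- (v * r))%R.
move: (p + q * c)%R (s' - c * q')%R (r' - c * p')%R => {}p {}s' {}r' act.
have [[e1 _ e3 e4] _ _] := act.
have r'0 : r' = 0%R.
  by move: e3; rewrite mul0r add0r => sr'; rewrite -[r']mul1r -vs -mulrA sr' mulr0.
have ss' : (s * s' = 1)%R by rewrite -e4 mul0r add0r.
have pp' : (p * p' = 1)%R by rewrite -e1 r'0 mulr0 addr0.
have p'p := left_inverse_unit finA pp'; have s's := left_inverse_unit finA ss'.
have := pair_action_mul (- (p' * q))%R ij act.
rewrite mul0r addr0 mulrN mulrA pp' mul1r subrr r'0 mulr0 subr0.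
set b := (- (p' * q))%R; move: (q' - b * s')%R => q2' act3.
have [[_ e2 _ _] _ _] := act3.
have q2'0 : q2' = 0%R.
  by move: e2; rewrite mul0r addr0 => pq'; rewrite -[q2']mul1r -p'p -mulrA pq' mulr0.
rewrite q2'0 in act3; exists (g * x i j a * x j i c * x i j b), (- b)%R, (- c)%R, (- a)%R.
split; first exact: (pair_action_diagonal ij pp' p'p ss' s's).
by rewrite !st_opp // !mulgK.
Qed.

End SteinbergTheory.

(** * Finite colourings and finite index *)

Definition finitely_many_classes (T : Type) (E : T -> T -> Prop) : Prop :=
  exists (F : finType) (c : T -> F), forall x y, c x = c y -> E x y.

Section Colourings.
Variables (T : Type).
Implicit Types E : T -> T -> Prop.

Lemma classes_sub E E' : (forall x y, E x y -> E' x y) ->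
  finitely_many_classes E -> finitely_many_classes E'.
Proof. by move=> EE' [F [c cE]]; exists F, c => x y /cE /EE'. Qed.

Lemma classes_preim (U : Type) (h : U -> T) E : finitely_many_classes E ->
  finitely_many_classes (fun x y => E (h x) (h y)).
Proof. by move=> [F [c cE]]; exists F, (c \o h) => x y /cE. Qed.

Lemma classes_and E E' : finitely_many_classes E -> finitely_many_classes E' ->
  finitely_many_classes (fun x y => E x y /\ E' x y).
Proof.
move=> [F [c cE]] [F' [c' cE']]; exists (F * F')%type, (fun x => (c x, c' x)).
by move=> x y [/cE ? /cE'].
Qed.

Lemma classes_all (I : finType) (E : I -> T -> T -> Prop) :
  (forall i, finitely_many_classes (E i)) ->
  finitely_many_classes (fun x y => forall i, E i x y).
Proof.
move=> fE; have [F FP] := choice fE.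
have [c cP] : exists c : forall i, T -> F i, forall i x y, c i x = c i y -> E i x y.
  exists (fun i => projT1 (cid (FP i))) => i.
  exact: (projT2 (cid (FP i))).
exists {dffun forall i, F i}, (fun x => [ffun i => c i x] : {dffun forall i, F i}).
by move=> x y /ffunP e i; apply: cP; have := e i; rewrite !ffunE.
Qed.

End Colourings.

Lemma classes_seq (T : choiceType) (s : seq T) :
  finitely_many_classes (fun x y => x \in s -> y \in s -> x = y).
Proof.
exists (option (seq_sub s)), insub => x y + xs ys.
by rewrite !insubT => -[].
Qed.

Lemma classes_finite (T : choiceType) :
  finite_type T -> finitely_many_classes (@eq T).
Proof.
move=> [s sP]; apply: classes_sub (classes_seq s) => x y; apply; exact: sP.
Qed.

Lemma finite_of_classes (T : eqType) : finitely_many_classes (@eq T) -> finite_type T.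
Proof.
move=> [F [c cP]].
pose t f : seq T := if pselect (exists x, c x = f) is left h
  then [:: projT1 (cid h)] else [::].
exists (flatten [seq t f | f <- enum F]) => x; apply/flatten_mapP.
exists (c x); first by rewrite mem_enum.
rewrite /t; case: pselect => [h|[]]; last by exists x.
by rewrite inE; apply/eqP/cP; rewrite (projT2 (cid h)).
Qed.

Lemma classes_representatives (T : Type) (x0 : T) (E : T -> T -> Prop) :
  finitely_many_classes E ->
  exists (F : finType) (c : T -> F) (r : F -> T),
    (forall x y, c x = c y -> E x y) /\ (forall x, c (r (c x)) = c x).
Proof.
move=> [F [c cE]].
have [r rP] : exists r : F -> T, forall f, (exists x, c x = f) -> c (r f) = f.
  suff : forall f, exists y, (exists x, c x = f) -> c y = f by move=> /choice[r rP]; exists r.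
  move=> f.
  have [[x cx]|no] := pselect (exists x, c x = f); first by exists x.
  by exists x0 => /no.
by exists F, c, r; split=> // x; apply: rP; exists x.
Qed.


Section Schreier.
Variables (G : groupType) (H : groupClosed G).

(** Schreier's lemma.  The representatives [r] need not contain the neutral
    element and [c] may separate elements of one coset, so [(r (c 1))^-1]
    and the representatives lying in [H] are added to the usual Schreier generators. *)
Lemma schreier (s : seq G) : (forall g, g \in generated [set` s]) ->
  finitely_many_classes (fun x y => x^-1 * y \in H) ->
  exists t : seq G, {subset t <= H} /\ {subset H <= generated [set` t]}.
Proof.
move=> sG /(classes_representatives (1 : G)) [F [c [r [cH rc]]]].
pose gens : seq G :=
  [seq (r (c (y * r f)))^-1 * (y * r f) | y <- s ++ [seq y^-1 | y <- s], f <- enum F]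
  ++ (r (c 1))^-1 :: [seq y <- [seq r f | f <- enum F] | y \in H].
have gens1 y f : y \in s \/ y^-1 \in s ->
    (r (c (y * r f)))^-1 * (y * r f) \in generated [set` gens].
  move=> ys; apply: mem_generated; rewrite /= mem_cat.
  apply/orP; left; apply/allpairsP; exists (y, f); split=> //=; last by rewrite mem_enum.
  by rewrite mem_cat; case: ys => [->//|ys]; rewrite -[y]invgK map_f ?orbT.
have gensH : {subset gens <= H}.
  move=> y; rewrite mem_cat inE mem_filter => /or3P[|/eqP->|/andP[]//].
    by move=> /allpairsP[[a f] /= [_ _ ->]]; apply/cH/rc.
  by rewrite -[_^-1]mulg1; apply/cH/rc.
exists gens; split=> // h Hh.
have [w [f [Ww hE]]] : exists w f, w \in generated [set` gens] /\ h = r f * w.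
  rewrite -[h]invgK; have := sG h^-1; move: (h^-1) => g.
  have step g0 y : (exists w f, w \in generated [set` gens] /\ g0^-1 = r f * w) ->
      y \in s \/ y^-1 \in s -> exists w f, w \in generated [set` gens] /\ (g0 * y^-1)^-1 = r f * w.
    move=> [w [f [Ww e]]] ys.
    exists ((r (c (y * r f)))^-1 * (y * r f) * w), (c (y * r f)); split.
      by rewrite gpredM // gens1.
    by rewrite invgM invgK e !mulgA mulgV mul1g.
  elim/generated_ind => [|g0 y IH ys|g0 y IH ys].
  - exists (r (c 1))^-1, (c 1); rewrite invg1 mulgV; split=> //.
    by apply: mem_generated; rewrite /= mem_cat inE eqxx orbT.
  - by rewrite -[y]invgK; apply: step => //; right; rewrite invgK.
  - by apply: step => //; left.
rewrite hE gpredMr //; apply: mem_generated => /=.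
rewrite mem_cat inE mem_filter; apply/or3P/Or33/andP; split; last first.
  by rewrite map_f // mem_enum.
have HW : w \in H by move: Ww; apply: generated_sub => y /= /gensH.
by rewrite -(gpredMr _ HW) -hE.
Qed.

Lemma finitely_generated_subgroup (t : seq G) :
  {subset t <= H} -> {subset H <= generated [set` t]} ->
  finitely_generated (subgroup_type H).
Proof.
move=> tH Ht; exists (pmap insub t) => z.
have: exists2 y : subgroup_type H, val y = val z & y \in generated [set` pmap insub t].
  have lift g : g \in t -> exists2 y : subgroup_type H, val y = g & y \in pmap insub t.
    move=> gt; exists (Sub g (tH _ gt) : subgroup_type H); first exact: SubK.
    by rewrite mem_pmap_sub SubK.
  have := Ht _ (valP z); move: (val z) => g.
  elim/generated_ind => [|h x [y <- Wy] /= /lift[u <- tu]|h x [y <- Wy] /= /lift[u <- tu]].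
  - by exists 1; rewrite ?val1 ?gpred1.
  - by exists (y * u); rewrite ?valM // gpredM // mem_generated.
  - by exists (y * u^-1); rewrite ?valM ?gmulfV // gpredF // mem_generated.
by move=> [y /val_inj ->].
Qed.

End Schreier.

Section AbelianTorsion.
Variable G : groupType.

Lemma generated_commuting_finite (s : seq G) :
  (forall x, x \in s -> exists n, x ^+ n.+1 = 1) ->
  (forall x y, x \in s -> y \in s -> commute x y) ->
  exists l : seq G, forall g, g \in generated [set` s] -> g \in l.
Proof.
elim: s => [|x s IHs] tor com.
  by exists [:: 1] => g; elim/generated_ind => //; rewrite inE.
have [||l lP] := IHs.
- by move=> y ys; apply: tor; rewrite inE ys orbT.
- by move=> y z ys zs; apply: com; rewrite inE ?ys ?zs orbT.
have [n xn] := tor x (mem_head x s).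
have comx y : y \in generated [set` s] -> commute x y.
  elim/generated_ind => [|h z xh /= zs|h z xh /= zs]; first exact: commute1.
    by apply: commuteM => //; apply: com; rewrite inE ?eqxx ?zs ?orbT.
  by apply: commuteM => //; apply: commuteV; apply: com; rewrite inE ?eqxx ?zs ?orbT.
exists [seq x ^+ (i : nat) * y | i <- index_iota 0 n.+1, y <- l] => g sg.
suff [i [y [Wy ->]]] : exists i y, y \in generated [set` s] /\ g = x ^+ i * y.
  apply/allpairsP; exists (i %% n.+1, y)%N; split; rewrite /= ?lP //.
    by rewrite mem_index_iota ltn_mod.
  congr (_ * _).
  by rewrite {1}(divn_eq i n.+1) expgnDr mulnC expgnA xn expg1n mul1g.
have xV : x^-1 = x ^+ n by apply: mulg1_eq; rewrite -expgS.
have mulx i y k : y \in generated [set` s] -> x ^+ i * y * x ^+ k = x ^+ (i + k) * y.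
  by move=> /comx xy; rewrite expgnDr -!mulgA; congr (_ * _); exact/commuteX/commute_sym.
move: sg; elim/generated_ind => [|_ z [i [y [Wy ->]]] /=|_ z [i [y [Wy ->]]] /=].
- by exists 0%N, 1; rewrite gpred1 mulg1.
- rewrite inE => /orP[/eqP->|zs].
    by exists (i + 1)%N, y; split=> //; rewrite -(mulx i y 1%N Wy).
  by exists i, (y * z); split; [apply: gpredM => //; apply: mem_generated | rewrite mulgA].
- rewrite inE => /orP[/eqP->|zs].
    by exists (i + n)%N, y; split=> //; rewrite -(mulx i y n Wy) xV.
  by exists i, (y * z^-1); split; [apply: gpredF => //; apply: mem_generated | rewrite mulgA].
Qed.

Lemma finite_abelian_torsion : finitely_generated G -> torsion G ->
  abelian_group G -> finite_type G.
Proof.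
move=> [s sG] tor ab; have [||l lP] := @generated_commuting_finite s.
- move=> x _; apply: contrapT => no; apply: (tor x) => -[//|n] _ xn.
  by apply: no; exists n.
- by move=> x y _ _; apply: ab.
by exists l => g; apply: lP.
Qed.

End AbelianTorsion.

(** * Unipotent subgroups *)

Definition finite_pred (T : eqType) (P : T -> Prop) : Prop :=
  exists s : seq T, forall x, P x -> x \in s.

Section UpperUnipotent.
Variables (A : pzRingType) (S : groupType) (m : nat) (x : 'I_m -> 'I_m -> A -> S).
Hypothesis xS : steinberg x.
Implicit Types (i j k l p q : 'I_m) (a b c : A) (g u : S).

Definition upper : set S := [set g | exists i j a, i < j /\ g = x i j a].

Lemma ltn_ord_neq i j : i < j -> i != j.
Proof. by move=> ij; rewrite -val_eqE /= ltn_eqF. Qed.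

(** Numbers the positive roots injectively, higher roots first, so that
    conjugating by a root element changes a root element only by root elements
    of smaller number. *)
Definition root_rank i j : nat := (m - (j - i)) * m + i.

Lemma root_rank_inj i j k l : i < j -> k < l -> root_rank i j = root_rank k l -> i = k /\ j = l.
Proof.
move=> ij kl e; have ik : i = k.
  apply: val_inj; have := congr1 (modn^~ m) e.
  by rewrite /root_rank !modnMDl !modn_small.
split=> //; apply: val_inj => /=; move: e; rewrite ik in ij *; rewrite /root_rank => /eqP.
have m0 : 0 < m by apply: leq_ltn_trans (ltn_ord i).
rewrite eqn_add2r eqn_pmul2r // => /eqP e.
have le (n : 'I_m) : n - k <= m by rewrite (leq_trans (leq_subr _ _)) // ltnW.
have : j - k = l - k by rewrite -(subKn (le j)) e subKn.
by move=> /(congr1 (addn k)); rewrite !subnKC // ltnW.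
Qed.

Lemma root_rank_lt i j k l : l - k < j - i -> root_rank i j < root_rank k l.
Proof.
move=> lt; rewrite /root_rank; apply: (@leq_trans ((m - (l - k)) * m)); last exact: leq_addr.
apply: (@leq_trans ((m - (j - i)).+1 * m)).
  by rewrite mulSnr ltn_add2l.
rewrite leq_mul2r ltn_sub2l ?orbT // (leq_trans lt) // (leq_trans (leq_subr _ _)) //.
exact: ltnW.
Qed.

Lemma upper_conj i j k l a b : i < j -> k < l ->
  x k l b ^ x i j a = x k l b \/
  exists p q c, [/\ p < q, l - k < q - p & x k l b ^ x i j a = x k l b * x p q c].
Proof.
move=> ij kl; have [nij nkl] := (ltn_ord_neq ij, ltn_ord_neq kl).
have [li|nli] := eqVneq l i.
  have kj : k < j by rewrite (ltn_trans kl) // li.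
  right; exists k, j, (b * a)%R; split; rewrite // ?li ?ltn_sub2r //.
  by subst l; rewrite (st_conj_right xS) // ltn_ord_neq.
have [kj|nkj] := eqVneq k j.
  have il : i < l by rewrite (ltn_trans ij) // -kj.
  right; exists i, l, (- (a * b))%R; split; rewrite // ?kj ?ltn_sub2l // -?kj //.
  by subst k; rewrite (st_conj_left xS) // ltn_ord_neq.
by left; apply: (st_conj_commute xS).
Qed.

Definition upper_below n : set S :=
  [set g | exists i j a, [/\ i < j, root_rank i j < n & g = x i j a]].

Hypothesis finA : finite_type A.

(** The root subgroup of number [n] normalizes the group generated by the
    previous ones, so each step multiplies by one finite root subgroup. *)
Lemma finite_upper_below n : finite_pred (fun u => u \in generated (upper_below n)).
Proof.
elim: n => [|n [s sP]].
  exists [:: 1] => g; elim/generated_ind => [|h y _ [i [j [a []]]]|h y _ [i [j [a []]]]] //.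
  by rewrite inE.
have [[i [j [ij lij]]]|none] := pselect (exists i j, i < j /\ root_rank i j = n); last first.
  exists s => g Ug; apply: sP; apply: generated_sub Ug => y [i [j [a [ij lij ->]]]].
  apply: mem_generated; exists i, j, a; split=> //.
  by rewrite ltn_neqAle -ltnS lij andbT; apply/eqP=> e; apply: none; exists i, j.
have [sA sAP] := finA; exists [seq u * x i j a | u <- s, a <- sA] => g Ug.
suff [u [a [/sP us ->]]] : exists u a, u \in generated (upper_below n) /\ g = u * x i j a.
  exact: allpairs_f.
have nij := ltn_ord_neq ij.
have step h y : (exists u a, u \in generated (upper_below n) /\ h = u * x i j a) ->
    upper_below n.+1 y -> exists u a, u \in generated (upper_below n) /\ h * y = u * x i j a.
  move=> [u [a [Uu ->]]] [k [l [b [kl lkl ->]]]].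
  have [e|ne] := eqVneq (root_rank k l) n.
    have [-> ->] : k = i /\ l = j by apply: root_rank_inj; rewrite // lij.
    by exists u, (a + b)%R; split=> //; rewrite (st_add xS) // mulgA.
  have lt : root_rank k l < n by rewrite ltn_neqAle ne -ltnS.
  have kln c : x k l c \in generated (upper_below n).
    by apply: mem_generated; exists k, l, c.
  exists (u * x k l b ^ x i j (- a)%R), a; split; last first.
    by rewrite (st_opp xS) // -mulgA (conjgCV (x _ _ _)) mulgA.
  rewrite gpredM //; have [->//|[p [q [c [pq h2 ->]]]]] := upper_conj (- a)%R b ij kl.
  rewrite gpredM //; apply: mem_generated; exists p, q, c; split=> //.
  exact: ltn_trans (root_rank_lt h2) lt.
move: Ug; elim/generated_ind => [|h y IH Uy|h y IH [k [l [b [kl lt ->]]]]].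
- by exists 1, 0%R; rewrite gpred1 (st_zero xS) // mulg1.
- exact: step.
- rewrite -(st_opp xS) ?ltn_ord_neq //; apply: step => //.
  by exists k, l, (- b)%R.
Qed.

Lemma finite_upper : finite_pred (fun u => u \in generated upper).
Proof.
have [s sP] := finite_upper_below (m.+1 * m); exists s => g Ug; apply: sP.
apply: generated_sub Ug => _ [i [j [a [ij ->]]]]; apply: mem_generated.
exists i, j, a; split=> //; rewrite /root_rank mulSnr.
by rewrite -addnS leq_add // leq_mul2r leq_subr orbT.
Qed.

Section SimpleRoot.
Variables (p q : 'I_m) (pq : val q = (val p).+1).
Let lt_pq : p < q. Proof. by rewrite -[nat_of_ord q]/(val q) pq. Qed.
Let npq : p != q. Proof. exact: ltn_ord_neq. Qed.
Let nqp : q != p. Proof. by rewrite eq_sym. Qed.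

Definition upper_except : set S :=
  [set g | exists i j a, [/\ i < j, (i, j) != (p, q) & g = x i j a]].

(** For a simple root [(p, q)] the remaining positive roots are closed under
    adding the root or its opposite: this is where [q = p + 1] matters, since no
    index lies strictly between [p] and [q]. *)
Lemma upper_except_conj a u : u \in generated upper_except ->
  u ^ x p q a \in generated upper_except /\ u ^ x q p a \in generated upper_except.
Proof.
move=> Uu; split; apply: generated_conj Uu => _ [k [l [b [kl npq_kl ->]]]].
all: have nkl := ltn_ord_neq kl.
all: have Ukl : x k l b \in generated upper_except
  by apply: mem_generated; exists k, l, b.
all: have mem i j c : i < j -> (i, j) != (p, q) -> x i j c \in generated upper_except
  by move=> ij nij; apply: mem_generated; exists i, j, c.
- have [lp|nlp] := eqVneq l p.
    subst l; have kq := ltn_trans kl lt_pq.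
    rewrite (st_conj_right xS) // ?ltn_ord_neq // gpredM // mem //.
    by rewrite xpair_eqE (negPf nkl).
  have [kq|nkq] := eqVneq k q.
    subst k; have pl := ltn_trans lt_pq kl.
    rewrite (st_conj_left xS) // ?ltn_ord_neq // gpredM // mem //.
    by rewrite xpair_eqE eq_sym (negPf nkl) andbF.
  by rewrite (st_conj_commute xS).
- have [lq|nlq] := eqVneq l q.
    subst l; have nkp : k != p by move: npq_kl; rewrite xpair_eqE eqxx andbT.
    have kp : k < p.
      by move: kl; rewrite -[nat_of_ord q]/(val q) pq ltnS ltn_neqAle => ->; rewrite andbT.
    rewrite (st_conj_right xS) // gpredM // mem //.
    by rewrite xpair_eqE (negPf nkp).
  have [kp|nkp] := eqVneq k p.
    subst k; have nql : q != l by rewrite eq_sym.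
    have ql : q < l.
      by rewrite ltn_neqAle -[nat_of_ord q]/(val q) pq kl andbT -pq.
    rewrite (st_conj_left xS) // gpredM // mem //.
    by rewrite xpair_eqE (negPf nqp).
  by rewrite (st_conj_commute xS).
Qed.

Lemma upper_split u : u \in generated upper ->
  exists v a, v \in generated upper_except /\ u = v * x p q a.
Proof.
have step h y : (exists v a, v \in generated upper_except /\ h = v * x p q a) ->
    upper y -> exists v a, v \in generated upper_except /\ h * y = v * x p q a.
  move=> [v [a [Uv ->]]] [k [l [b [kl ->]]]].
  have [[-> ->]|ne] := eqVneq (k, l) (p, q).
    by exists v, (a + b)%R; split=> //; rewrite (st_add xS) // mulgA.
  have Ukl : x k l b \in generated upper_except.
    by apply: mem_generated; exists k, l, b.
  have [Uc _] := upper_except_conj (- a)%R Ukl.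
  exists (v * x k l b ^ x p q (- a)%R), a; split; first exact: gpredM.
  by rewrite (st_opp xS) // -mulgA (conjgCV (x _ _ _)) mulgA.
elim/generated_ind => [|h y IH Uy|h y IH [k [l [b [kl ->]]]]].
- by exists 1, 0%R; rewrite gpred1 (st_zero xS) // mulg1.
- exact: step.
- rewrite -(st_opp xS) ?ltn_ord_neq //; apply: step => //.
  by exists k, l, (- b)%R.
Qed.

End SimpleRoot.
End UpperUnipotent.

Section Opposite.
Variables (A : pzRingType) (S : groupType) (m : nat) (x : 'I_m -> 'I_m -> A -> S).

(** Reversing the indices exchanges the positive and the negative roots, so
    statements about [upper x] also apply to lower triangular elements. *)
Definition opposite (i j : 'I_m) (a : A) : S := x (rev_ord i) (rev_ord j) a.

Lemma opposite_steinberg : steinberg x -> steinberg opposite.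
Proof.
move=> xS; have rev_neq (i j : 'I_m) : i != j -> rev_ord i != rev_ord j.
  by apply: contra_neq; apply: rev_ord_inj.
split=> [i j a b ij|i j k l a b ij kl jk il|i j k a b ij jk ik].
- by apply: (st_add xS); apply: rev_neq.
- by apply: (st_commute xS); apply: rev_neq.
- by apply: (st_comm xS); apply: rev_neq.
Qed.

Lemma rev_ord_lt (i j : 'I_m) : j < i -> rev_ord i < rev_ord j.
Proof. by move=> ji; apply: ltn_sub2l => //; apply: leq_ltn_trans ji (ltn_ord i). Qed.

Lemma oppositeE i j a : x i j a = opposite (rev_ord i) (rev_ord j) a.
Proof. by rewrite /opposite !rev_ordK. Qed.

End Opposite.

(** * Perfect groups with centre of finite index *)

Section CentralFiniteIndex.
Variable S : groupType.

Definition center : {pred S} := fun z => `[< central z >].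

Fact center_mul : mulg_closed center.
Proof.
move=> y z /asboolP cy /asboolP cz; apply/asboolP=> u; apply: commute_sym.
by apply: commuteM; apply: commute_sym.
Qed.
Fact center_one : 1 \in center.
Proof. by apply/asboolP=> y; apply/commute_sym/commute1. Qed.
Fact center_inv : invg_closed center.
Proof.
by move=> z /asboolP cz; apply/asboolP=> y; apply/commute_sym/commuteV/commute_sym/cz.
Qed.
HB.instance Definition _ := isMulClosed.Build S center center_mul.
HB.instance Definition _ := isMul1Closed.Build S center center_one.
HB.instance Definition _ := isInvClosed.Build S center center_inv.

Lemma center_normal : normal_subgroup center.
Proof. by move=> z y cz; have /asboolP/(_ y) <- := cz; rewrite mulgK. Qed.

Local Notation Z := (subgroup_type center).
Local Notation Q := (quotient_group center_normal).
Local Notation pr := (quotient_map center_normal).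

Fact center_mulC : @commutative Z Z *%g.
Proof. by move=> y z; apply: val_inj; rewrite !valM; have /asboolP := valP y; apply. Qed.

HB.instance Definition _ := SemiGroup.isCommutativeLaw.Build Z *%g center_mulC.

Hypothesis fin : finitely_many_classes (fun g h : S => g^-1 * h \in center).

Lemma finite_center_quotient : finite_type Q.
Proof.
have [r rP] := choice (quotient_map_surj (nN := center_normal)).
apply/finite_of_classes/classes_sub/(classes_preim r fin) => u v /=.
by rewrite -{2}[u]rP -{2}[v]rP => /quotient_mapP.
Qed.

(** The transfer [tau] into the centre is a homomorphism to an abelian group,
    hence trivial on commutators, while it sends a central [z] to its power by
    the index of the centre. *)
Lemma central_exponent :
  (forall g, g \in generated [set y | exists a b : S, y = [~ a, b]]) ->
  exists n, forall z, z \in center -> z ^+ n.+1 = 1.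
Proof.
move=> perfect; have [s' s'P] := finite_center_quotient.
have [s [us sP]] : exists s : seq Q, uniq s /\ forall u, u \in s.
  by exists (undup s'); split=> [|u]; rewrite ?undup_uniq ?mem_undup.
have [r rP] := choice (quotient_map_surj (nN := center_normal)).
have cocP g u : (r (pr g * u))^-1 * (g * r u) \in center.
  by apply/(quotient_mapP center_normal); rewrite quotient_mapM !rP.
pose coc g u : Z := exist (fun z => z \in center) _ (cocP g u).
pose tau g := \prod_(u <- s) coc g u.
(* Left multiplication by [h] permutes the cosets, which reindexes the factor
   coming from [g]. *)
have tauM g h : tau (g * h) = tau g * tau h.
  have perm : perm_eq [seq pr h * u | u <- s] s.
    apply: uniq_perm => // [|u]; first by rewrite map_inj_uniq //; apply: mulgI.
    rewrite sP; apply/mapP; exists ((pr h)^-1 * u) => //; by rewrite mulVKg.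
  have -> : tau g = \prod_(u <- s) coc g (pr h * u).
    by rewrite /tau -(perm_big _ perm) big_map.
  rewrite /tau -big_split; apply: eq_bigr => u _ /=.
  by apply: val_inj; rewrite valM /= quotient_mapM !mulgA mulgK.
have tau_perfect g : tau g = 1.
  have tau1 : tau 1 = 1 by apply: (mulgI (tau 1)); rewrite -tauM !mulg1.
  have tauV h : tau h^-1 = (tau h)^-1.
    by apply/esym/mulg1_eq; rewrite -tauM mulgV.
  elim/generated_ind: g / (perfect g) => // h y th [a [b ->]].
    rewrite tauM th commgEl conjgE !tauM !tauV (center_mulC (tau a)) mulKg.
    by rewrite mulVg mulg1.
  rewrite tauM th tauV commgEl conjgE !tauM !tauV (center_mulC (tau a)) mulKg.
  by rewrite mulVg invg1 mulg1.
have s0 : 0 < size s by have := sP 1; case: (s).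
exists (size s).-1 => z cz; rewrite prednK //.
have prz : pr z = 1 by apply/esym/(quotient_mapP center_normal); rewrite invg1 mul1g.
have cocz u : coc z u = exist (fun z => z \in center) z cz.
  apply: val_inj; rewrite /= prz mul1g.
  by have /asboolP/(_ (r u)) -> := cz; rewrite mulKg.
have := tau_perfect z; rewrite /tau (eq_bigr (fun=> exist (fun z => z \in center) z cz : Z)) => [|u _]; last exact: cocz.
by rewrite big_const_seq count_predT iter_mulg_1 => /(congr1 val); rewrite gmulfXn val1.
Qed.

(** By Schreier's lemma the centre is finitely generated; being abelian of finite
    exponent, it is finite. *)
Lemma finite_perfect : (exists s : seq S, forall g, g \in generated [set` s]) ->
  (forall g, g \in generated [set y | exists a b : S, y = [~ a, b]]) -> finite_type S.
Proof.
move=> [s sS] /central_exponent [n Zn].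
have [t [tZ Zt]] := schreier sS fin.
have [||l lP] := @generated_commuting_finite _ t.
- by move=> z /tZ /Zn; exists n.
- by move=> y z /tZ/asboolP cy _; apply: cy.
have [F [c [r [cE rc]]]] := classes_representatives 1 fin.
exists [seq r f * z | f <- enum F, z <- l] => g.
apply/allpairsP; exists (c g, (r (c g))^-1 * g); split; rewrite /= ?mem_enum ?mulVKg //.
by apply/lP/Zt/cE/rc.
Qed.

End CentralFiniteIndex.

(** * Finiteness of Steinberg groups over finite rings *)

Section SteinbergFinite.
Variables (A : pzRingType) (S : groupType) (m : nat) (x : 'I_m -> 'I_m -> A -> S).
Hypotheses (m3 : 2 < m) (xS : steinberg x) (finA : finite_type A).
Hypothesis gen : forall g,
  g \in generated [set g | exists i j a, i != j /\ g = x i j a].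

Let y := opposite x.
Let yS : steinberg y := opposite_steinberg xS.

(** Keeping all negative roots but only the simple positive ones leaves two cases
    in [bounded_generation]. *)
Definition simple_generators : set S := [set g |
  (exists (i j : 'I_m) a, j < i /\ g = x i j a) \/
  (exists (p q : 'I_m) a, val q = (val p).+1 /\ g = x p q a)].

Lemma simple_generatorsP g : g \in generated simple_generators.
Proof.
have := gen g; apply: generated_sub => _ [i [j [a [ij ->]]]].
case: (ltngtP i j) => [lt|gt|/val_inj e]; last by rewrite e eqxx in ij.
  have: j = i + (j - i.+1).+1 :> nat by rewrite addnS -addSn subnKC.
  move: (j - i.+1) => n; elim: n i a lt {ij} => [|n IHn] i a lt e.
    by apply: mem_generated; right; exists i, j, a; split=> //=; rewrite e addn1.
  have qm : i.+1 < m.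
    by apply: leq_ltn_trans (ltn_ord j); rewrite e -addn1 leq_add2l.
  pose q := Ordinal qm; have qj : q < j by rewrite e /= -addn1 ltn_add2l.
  have [iq jq ij] : [/\ i != q, q != j & i != j].
    by split; apply: ltn_ord_neq => //=.
  rewrite -[a]mulr1 -(st_comm xS a 1%R iq jq ij) gpredR //.
    by apply: mem_generated; right; exists i, q, a.
  by apply: IHn => //; rewrite e /= addSn -addnS.
by apply: mem_generated; left; exists i, j, a.
Qed.

Lemma lowerP (i j : 'I_m) a : j < i -> x i j a \in generated (upper y).
Proof.
move=> ji; apply: mem_generated; rewrite oppositeE; do 3!eexists; split; last by [].
exact: rev_ord_lt.
Qed.

(** [upper_split] for the opposite family, with the two factors exchanged. *)
Lemma lower_split (p q : 'I_m) v : val q = (val p).+1 -> v \in generated (upper y) ->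
  exists w a, (forall b, w ^ x p q b \in generated (upper y)) /\ v = x q p a * w.
Proof.
move=> pq Lv.
have rpq : val (rev_ord p) = (val (rev_ord q)).+1.
  have qm := ltn_ord q; rewrite /= -[nat_of_ord q]/(val q) pq subnSK // -pq //.
have [w [a [Lw ->]]] := upper_split yS rpq Lv.
exists (w ^ x q p a), a.
have yqp c : y (rev_ord q) (rev_ord p) c = x q p c by rewrite /y -oppositeE.
have ypq c : y (rev_ord p) (rev_ord q) c = x p q c by rewrite /y -oppositeE.
have qp : q != p by rewrite eq_sym ltn_ord_neq // -[nat_of_ord q]/(val q) pq.
have [Lwa _] := upper_except_conj yS rpq a Lw.
rewrite yqp in Lwa *; split; last exact: conjgC.
move=> b; have [_] := upper_except_conj yS rpq b Lwa; rewrite ypq.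
by apply: generated_sub => _ [i [j [c [ij _ ->]]]]; apply: mem_generated; exists i, j, c.
Qed.

Lemma diagonal_upper t u : acts_diagonally x t -> u \in generated (upper y) ->
  u ^ t \in generated (upper y).
Proof.
move=> [d [d' [_ dP]]]; apply: generated_conj => _ [i [j [a [ij ->]]]].
rewrite /y /opposite dP; last by rewrite (inj_eq rev_ord_inj) ltn_ord_neq.
by apply: mem_generated; do 3!eexists; split; first exact: ij.
Qed.

Lemma diagonal_upper_except p q t u : acts_diagonally x t ->
  u \in generated (upper_except x p q) -> u ^ t \in generated (upper_except x p q).
Proof.
move=> [d [d' [_ dP]]]; apply: generated_conj => _ [i [j [a [ij ne ->]]]].
by rewrite dP ?ltn_ord_neq //; apply: mem_generated; do 3!eexists; split; first exact: ij.
Qed.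

(** The product set [T U- U U-] is stable under right multiplication by a simple
    root element [x_pq(a)].  Write the last factor as [x_qp(b) w] and the third
    as [u x_pq(c)], where [w] and [u] involve only the other roots and stay
    unipotent when conjugated by [X_pq] or [X_qp].  Then [x_pq(a)] moves past
    [w] and the rank-one word [x_pq(c) x_qp(b) x_pq(a)] is rewritten in
    [T X_qp X_pq X_qp], whose outer factors are absorbed on both sides. *)
Lemma bounded_generation g : exists t v u w, [/\ acts_diagonally x t,
  v \in generated (upper y), u \in generated (upper x), w \in generated (upper y) &
  g = t * v * u * w].
Proof.
pose P g := exists t v u w, [/\ acts_diagonally x t, v \in generated (upper y),
  u \in generated (upper x), w \in generated (upper y) & g = t * v * u * w].
have step h z : P h -> simple_generators z -> P (h * z).
  move=> [t [v [u [w [Tt Lv Uu Lw ->]]]]] [[i [j [a [ji ->]]]]|[p [q [a [pq ->]]]]].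
    exists t, v, u, (w * x i j a); split; rewrite ?mulgA //.
    by apply: gpredM => //; apply: lowerP.
  have lt : p < q by rewrite -[nat_of_ord q]/(val q) pq.
  have npq := ltn_ord_neq lt; have nqp : q != p by rewrite eq_sym.
  have [w1 [b [Lw1 ->]]] := lower_split pq Lw.
  have [u1 [c [Uu1 ->]]] := upper_split xS pq Uu.
  have pair d (i j : 'I_m) : (i, j) = (p, q) \/ (i, j) = (q, p) ->
      x i j d \in generated (root_pair x q p).
    move=> ij; apply: mem_generated; exists d.
    by case: ij => [[-> ->]|[-> ->]]; [right | left].
  have [|t1 [b1 [c1 [b2 [Tt1 e]]]]] :=
    @pair_decomposition _ _ _ _ m3 xS finA q p (x p q c * x q p b * x p q a) nqp.
    by rewrite !gpredM //; apply: pair; [left|right|left].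
  have Uu1t := diagonal_upper_except Tt1 Uu1.
  have [_ Uu2] := upper_except_conj xS pq b1 Uu1t.
  exists (t * t1), (v ^ t1 * x q p b1), ((u1 ^ t1) ^ x q p b1 * x p q c1),
    (x q p b2 * w1 ^ x p q a); split.
  - exact: acts_diagonallyM.
  - by apply: gpredM; [apply: diagonal_upper | apply: lowerP].
  - apply: gpredM; last by apply: mem_generated; exists p, q, c1.
    move: Uu2; apply: generated_sub => _ [i [j [d [ij _ ->]]]].
    by apply: mem_generated; exists i, j, d.
  - by apply: gpredM; [apply: lowerP | apply: Lw1].
  have -> : t * v * (u1 * x p q c) * (x q p b * w1) * x p q a
      = t * v * u1 * (x p q c * x q p b * x p q a) * w1 ^ x p q a.
    by rewrite -!mulgA; do 5!congr (_ * _); rewrite conjgE mulVKg.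
  by rewrite e !conjgE !mulgA !mulgK.
have := simple_generatorsP g; elim/generated_ind => [|h z|h z Ph] //.
- exists 1, 1, 1, 1; rewrite !gpred1 !mulg1; split=> //; exact: acts_diagonally1.
- exact: step.
move=> Xz; apply: step => //; case: Xz => [[i [j [a [ij ->]]]]|[p [q [a [pq ->]]]]].
  by left; exists i, j, (- a)%R; rewrite (st_opp xS) // eq_sym ltn_ord_neq.
right; exists p, q, (- a)%R; split=> //; rewrite (st_opp xS) // ltn_ord_neq //.
by rewrite -[nat_of_ord q]/(val q) pq.
Qed.

(** In [g = t v u w] the factors [v], [u], [w] take finitely many values, and so
    do the diagonal entries of [t]; if all of these agree for [g] and [h], then
    [g] and [h] differ by an element commuting with all root elements. *)
Lemma center_finite_index : finitely_many_classes (fun g h => g^-1 * h \in @center S).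
Proof.
have [t /choice[v /choice[u /choice[w gE]]]] := choice bounded_generation.
have /choice[d dP] : forall g, exists d : ('I_m -> A) * ('I_m -> A),
    forall i j a, i != j -> x i j a ^ t g = x i j (d.2 i * a * d.1 j)%R.
  by move=> g; have [[d [d' [_ dP]]] _ _ _ _] := gE g; exists (d, d').
have [sU sUP] := finite_upper xS finA; have [sL sLP] := finite_upper yS finA.
have fd := @classes_all S _ _ (fun i => classes_and
  (classes_preim (fun g => (d g).1 i) (classes_finite finA))
  (classes_preim (fun g => (d g).2 i) (classes_finite finA))).
have fv := classes_preim v (classes_seq sL).
have fu := classes_preim u (classes_seq sU).
have fw := classes_preim w (classes_seq sL).
apply: classes_sub (classes_and fd (classes_and fv (classes_and fu fw))).
move=> g h [dgh [vgh [ugh wgh]]].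
have [_ Lvg Uug Lwg eg] := gE g; have [_ Lvh Uuh Lwh eh] := gE h.
have {vgh ugh wgh} [ev eu ew] : [/\ v g = v h, u g = u h & w g = w h].
  by split; [apply: vgh | apply: ugh | apply: wgh]; rewrite ?sLP ?sUP.
have cz : central (t h * (t g)^-1).
  apply: (generated_central gen) => _ [i [j [a [ij ->]]]].
  apply: commute_sym; apply/commgP; rewrite -conjg_fix conjgM dP //.
  have [e1 _] := dgh j; have [_ e2] := dgh i.
  by rewrite -e1 -e2 -dP // conjgK.
have -> : g^-1 * h = t h * (t g)^-1.
  have tg : (t g)^-1 * g = v g * u g * w g by rewrite {2}eg -!mulgA mulKg.
  have {1}-> : h = t h * (t g)^-1 * g by rewrite -mulgA tg ev eu ew !mulgA.
  by rewrite cz mulKg.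
exact/asboolP.
Qed.

Theorem steinberg_finite : finite_type S.
Proof.
have [sA sAP] := finA; apply: (finite_perfect center_finite_index).
  exists [seq x ij.1 ij.2 a | ij <- enum {: 'I_m * 'I_m}, a <- sA] => g.
  have := gen g; apply: generated_sub => _ [i [j [a [ij ->]]]]; apply: mem_generated.
  by apply/allpairsP; exists ((i, j), a); rewrite mem_enum sAP.
move=> g; have := gen g; apply: generated_sub => _ [i [j [a [ij ->]]]].
have [k [ki kj]] := third_index i j m3; apply: mem_generated.
exists (x i k a), (x k j 1%R).
have ik : i != k by rewrite eq_sym.
by rewrite (st_comm xS) // mulr1.
Qed.

End SteinbergFinite.

(** * Elementary groups *)

Section ElementaryRelations.
Variables (R : pzRingType) (m : nat).
Local Notation E := (elementary_group R m).
Implicit Types (i j k l : 'I_m) (a b r : R).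

Fact root_exists i j r :
  exists g : E, i != j -> GLmx (val g) = elementary_mx i j r.
Proof.
have [->|ij] := eqVneq i j; first by exists 1.
have [g Eg eg] := elementary_mx_GL r ij.
by exists (Sub g (mem_generated Eg) : E); rewrite SubK.
Qed.

Definition root i j r : E := projT1 (cid (root_exists i j r)).

Lemma rootE i j r : i != j -> GLmx (val (root i j r)) = elementary_mx i j r.
Proof. exact: projT2 (cid (root_exists i j r)). Qed.

Lemma elementary_group_eq (g h : E) : GLmx (val g) = GLmx (val h) -> g = h.
Proof. by move/(@GLmx_inj _ _)/val_inj. Qed.

Lemma GLmxM (g h : E) : GLmx (val (g * h)) = (GLmx (val g) *m GLmx (val h))%R.
Proof. by rewrite valM. Qed.

Lemma mul_scaled_delta i j k l a b :
  ((a *: delta_mx i j) *m (b *: delta_mx k l) =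
   (if j == k then a * b else 0) *: delta_mx i l :> 'M[R]_m)%R.
Proof.
rewrite -scalemxAl; apply/matrixP=> u v; rewrite !mxE.
rewrite (bigD1 j) //= big1 => [|w wj]; last by rewrite !mxE (negPf wj) andbF mul0r.
rewrite !mxE eqxx andbT addr0.
by case: (u == i); case: (j == k); case: (v == l); rewrite /= ?(mulr0, mul0r, mulr1, mul1r).
Qed.

Lemma root_steinberg : steinberg root.
Proof.
split=> [i j a b ij|i j k l a b ij kl jk il|i j k a b ij jk ik].
- apply: elementary_group_eq; rewrite GLmxM !rootE // /elementary_mx.
  rewrite mulmxDl mul1mx mulmxDr mulmx1 mul_scaled_delta eq_sym (negPf ij).
  by rewrite scale0r addr0 scalerDl addrA addrAC.
- apply: elementary_group_eq; rewrite !GLmxM !rootE // /elementary_mx.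
  rewrite !mulmxDl !mul1mx !mulmxDr !mulmx1 !mul_scaled_delta (negPf jk) eq_sym (negPf il).
  by rewrite !scale0r !addr0 addrAC.
- apply: (mulgI (root j k b * root i j a)); rewrite -commgC.
  apply: elementary_group_eq; rewrite !GLmxM !rootE // /elementary_mx.
  rewrite !(mulmxDl, mul1mx, mulmxDr, mulmx1) !mul_scaled_delta eqxx.
  rewrite [k == i]eq_sym [j == i]eq_sym (negPf ij) (negPf ik) !scale0r !addr0.
  by rewrite !addrA; congr (_ + _)%R; rewrite addrAC.
Qed.

Lemma root_generated (g : E) :
  g \in generated [set g | exists i j r, i != j /\ g = root i j r].
Proof.
suff [h eh Wh] : exists2 h : E, val h = val g &
    h \in generated [set g | exists i j r, i != j /\ g = root i j r].
  by rewrite -(val_inj eh).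
have lift z : elementary z -> exists2 h : E, val h = z &
    exists i j r, i != j /\ h = root i j r.
  move=> [i [j [r [ij ez]]]]; exists (root i j r); last by exists i, j, r.
  by apply: GLmx_inj; rewrite rootE.
have := valP g; move: (val g) => z.
elim/generated_ind => [|z1 z2 [h <- Wh] /lift[h2 <- Xh2]|z1 z2 [h <- Wh] /lift[h2 <- Xh2]].
- by exists 1; rewrite ?val1 ?gpred1.
- by exists (h * h2); [rewrite valM | apply: gpredM => //; apply: mem_generated].
- by exists (h * h2^-1); [rewrite valM gmulfV | apply: gpredF => //; apply: mem_generated].
Qed.

End ElementaryRelations.

Section SteinbergFinitelyGenerated.
Variables (R : pzRingType) (S : groupType) (m : nat) (x : 'I_m -> 'I_m -> R -> S).
Hypotheses (m3 : 2 < m) (xS : steinberg x).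
Variable s : seq R.

Definition few_roots : seq S :=
  [seq x ij.1 ij.2 c | ij <- enum {: 'I_m * 'I_m}, c <- 1%R :: s].

(** The commutator relation makes these a subring: [x_ij(ab)] is a commutator of
    [x_ik(a)] and [x_kj(b)]. *)
Definition reachable : {pred R} :=
  fun r => `[< forall i j, i != j -> x i j r \in generated [set` few_roots] >].

Fact reachable_subring : subring_closed reachable.
Proof.
split=> [|a b /asboolP Ra /asboolP Rb|a b /asboolP Ra /asboolP Rb]; apply/asboolP=> i j ij.
- apply: mem_generated; apply/allpairsP; exists ((i, j), 1%R).
  by split; rewrite /= ?mem_enum ?mem_head.
- by rewrite (st_add xS) // (st_opp xS) // gpredF ?Ra ?Rb.
- have [k [ki kj]] := third_index i j m3; have ik : i != k by rewrite eq_sym.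
  by rewrite -(st_comm xS a b ik kj ij) gpredR ?Ra ?Rb.
Qed.
HB.instance Definition _ := GRing.isSubringClosed.Build R reachable reachable_subring.

Lemma few_roots_generate :
  (forall T : subringClosed R, {subset s <= T} -> forall r, r \in T) ->
  (forall g, g \in generated [set g | exists i j r, i != j /\ g = x i j r]) ->
  forall g, g \in generated [set` few_roots].
Proof.
move=> sR gen g; have := gen g; apply: generated_sub => _ [i [j [r [ij ->]]]].
suff /asboolP : r \in reachable by apply.
apply: sR => c sc; apply/asboolP=> k l kl; apply: mem_generated.
by apply/allpairsP; exists ((k, l), c); split; rewrite /= ?mem_enum ?inE ?sc ?orbT.
Qed.

End SteinbergFinitelyGenerated.

(** * Quotient rings and congruence quotients *)

Section QuotientRing.
Local Open Scope ring_scope.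
Local Open Scope quotient_scope.
Variables (R : pzRingType) (J : {pred R}).

Record two_sided_ideal : Prop := TwoSidedIdeal {
  ideal0 : 0 \in J;
  idealB : forall a b, a \in J -> b \in J -> a - b \in J;
  idealMl : forall a b, b \in J -> a * b \in J;
  idealMr : forall a b, a \in J -> a * b \in J }.

Hypothesis idJ : two_sided_ideal.

Definition ideal_rel : rel R := fun a b => b - a \in J.

Let idealN a : a \in J -> - a \in J.
Proof. by move=> Ja; rewrite -sub0r; apply: (idealB idJ) => //; apply: (ideal0 idJ). Qed.
Let idealD a b : a \in J -> b \in J -> a + b \in J.
Proof. by move=> Ja Jb; rewrite -[b]opprK; apply: (idealB idJ) => //; apply: idealN. Qed.

Fact ideal_rel_refl : reflexive ideal_rel.
Proof. by move=> a; rewrite /ideal_rel subrr (ideal0 idJ). Qed.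
Fact ideal_rel_sym : symmetric ideal_rel.
Proof. by move=> a b; apply/idP/idP=> /idealN; rewrite opprB. Qed.
Fact ideal_rel_trans : transitive ideal_rel.
Proof.
by move=> b a c ab bc; rewrite /ideal_rel -(subrK b c) -addrA; apply: idealD.
Qed.

Definition ideal_equiv := EquivRel ideal_rel ideal_rel_refl ideal_rel_sym ideal_rel_trans.
Definition quotient_ring : Type := {eq_quot ideal_equiv}.
HB.instance Definition _ := Choice.on quotient_ring.

Definition residue (a : R) : quotient_ring := \pi_({eq_quot ideal_equiv}) a.
Definition lift_residue (u : quotient_ring) : R := repr (u : {eq_quot ideal_equiv}).

Lemma lift_residueK u : residue (lift_residue u) = u. Proof. exact: reprK. Qed.

Lemma residueP a b : residue a = residue b <-> b - a \in J.
Proof. by split=> [/eqmodP | H]; [| apply/eqmodP]. Qed.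

Lemma lift_residueP a : lift_residue (residue a) - a \in J.
Proof. by apply/residueP; rewrite lift_residueK. Qed.

Definition residue_add (u v : quotient_ring) := residue (lift_residue u + lift_residue v).
Definition residue_mul (u v : quotient_ring) := residue (lift_residue u * lift_residue v).
Definition residue_opp (u : quotient_ring) := residue (- lift_residue u).

Let addE a b : residue_add (residue a) (residue b) = residue (a + b).
Proof.
apply/esym/residueP; rewrite opprD addrACA.
by apply: idealD; apply: lift_residueP.
Qed.
Let mulE a b : residue_mul (residue a) (residue b) = residue (a * b).
Proof.
apply/esym/residueP; set a' := lift_residue _; set b' := lift_residue _.
have -> : a' * b' - a * b = (a' - a) * b' + a * (b' - b).
  by rewrite mulrBl mulrBr addrA subrK.
apply: idealD; [apply: (idealMr idJ) | apply: (idealMl idJ)]; exact: lift_residueP.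
Qed.
Let oppE a : residue_opp (residue a) = residue (- a).
Proof.
by apply/residueP; rewrite opprK addrC; exact: lift_residueP.
Qed.

Fact residue_addA : associative residue_add.
Proof. by move=> u v w; rewrite -[u]lift_residueK -[v]lift_residueK -[w]lift_residueK !addE addrA. Qed.
Fact residue_addC : commutative residue_add.
Proof. by move=> u v; rewrite -[u]lift_residueK -[v]lift_residueK !addE addrC. Qed.
Fact residue_add0 : left_id (residue 0) residue_add.
Proof. by move=> u; rewrite -[u]lift_residueK addE add0r. Qed.
Fact residue_addN : left_inverse (residue 0) residue_opp residue_add.
Proof. by move=> u; rewrite -[u]lift_residueK oppE addE addNr. Qed.
HB.instance Definition _ := GRing.isZmodule.Build quotient_ring
  residue_addA residue_addC residue_add0 residue_addN.

Lemma residueD : {morph residue : a b / a + b}.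
Proof. by move=> a b; rewrite -addE. Qed.

Fact residue_mulA : associative residue_mul.
Proof. by move=> u v w; rewrite -[u]lift_residueK -[v]lift_residueK -[w]lift_residueK !mulE mulrA. Qed.
Fact residue_mul1 : left_id (residue 1) residue_mul.
Proof. by move=> u; rewrite -[u]lift_residueK mulE mul1r. Qed.
Fact residue_mulr1 : right_id (residue 1) residue_mul.
Proof. by move=> u; rewrite -[u]lift_residueK mulE mulr1. Qed.
Fact residue_mulDl : left_distributive residue_mul +%R.
Proof.
move=> u v w; rewrite -[u]lift_residueK -[v]lift_residueK -[w]lift_residueK.
by rewrite -residueD !mulE mulrDl residueD.
Qed.
Fact residue_mulDr : right_distributive residue_mul +%R.
Proof.
move=> u v w; rewrite -[u]lift_residueK -[v]lift_residueK -[w]lift_residueK.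
by rewrite -residueD !mulE mulrDr residueD.
Qed.
HB.instance Definition _ := GRing.Zmodule_isPzRing.Build quotient_ring
  residue_mulA residue_mul1 residue_mulr1 residue_mulDl residue_mulDr.

Lemma residueM : {morph residue : a b / a * b}.
Proof. by move=> a b; rewrite -mulE. Qed.

End QuotientRing.

Section SteinbergQuotient.
Variables (R : pzRingType) (S : groupType) (m : nat) (x : 'I_m -> 'I_m -> R -> S).
Hypotheses (m3 : 2 < m) (xS : steinberg x).
Hypothesis gen : forall g,
  g \in generated [set g | exists i j r, i != j /\ g = x i j r].
Variables (M : groupClosed S) (nM : normal_subgroup M).

Definition level_ideal : {pred R} :=
  fun r => `[< forall i j, i != j -> x i j r \in M >].

Lemma normal_commg g h : g \in M -> [~ g, h] \in M /\ [~ h, g] \in M.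
Proof.
move=> Mg; rewrite commgEl commgEr; split.
  rewrite gpredM ?gpredV //; have := nM h^-1 Mg; by rewrite invgK conjgE mulgA.
by rewrite gpredM //; have := nM h^-1 (_ : g^-1 \in M); rewrite gpredV invgK conjgE mulgA; apply.
Qed.

(** Normality of [M] turns a root element of [M] into commutators with arbitrary
    root elements, and a third index realizes left and right multiplication. *)
Lemma level_ideal_two_sided : two_sided_ideal level_ideal.
Proof.
split=> [|a b /asboolP Ja /asboolP Jb|a b /asboolP Jb|a b /asboolP Ja].
- by apply/asboolP=> i j ij; rewrite (st_zero xS) // gpred1.
- by apply/asboolP=> i j ij; rewrite (st_add xS) // (st_opp xS) // gpredF ?Ja ?Jb.
- apply/asboolP=> i j ij; have [k [ki kj]] := third_index i j m3.
  have ik : i != k by rewrite eq_sym.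
  by rewrite -(st_comm xS a b ik kj ij); apply: (normal_commg _ _).2; apply: Jb.
- apply/asboolP=> i j ij; have [k [ki kj]] := third_index i j m3.
  have ik : i != k by rewrite eq_sym.
  by rewrite -(st_comm xS a b ik kj ij); apply: (normal_commg _ _).1; apply: Ja.
Qed.

Local Notation A := (quotient_ring level_ideal_two_sided).
Local Notation pr := (quotient_map nM).

Definition quotient_root i j (u : A) : quotient_group nM := pr (x i j (lift_residue u)).

Lemma quotient_rootE i j r : i != j ->
  quotient_root i j (residue level_ideal_two_sided r) = pr (x i j r).
Proof.
move=> ij; apply/quotient_mapP; rewrite -(st_opp xS) // -(st_add xS) // addrC.
by have /asboolP := (residueP level_ideal_two_sided (lift_residue (residue level_ideal_two_sided r)) r).1 (lift_residueK _); apply.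
Qed.

Lemma quotient_map1 : pr 1 = 1.
Proof. by apply: (mulgI (pr 1)); rewrite -quotient_mapM !mulg1. Qed.
Lemma quotient_mapV g : pr g^-1 = (pr g)^-1.
Proof. by apply/esym/mulg1_eq; rewrite -quotient_mapM mulgV quotient_map1. Qed.

Lemma quotient_root_steinberg : steinberg quotient_root.
Proof.
have lift u : u = residue level_ideal_two_sided (lift_residue u) by rewrite lift_residueK.
split=> [i j u v ij|i j k l u v ij kl jk il|i j k u v ij jk ik].
- by rewrite (lift u) (lift v) -residueD !quotient_rootE // (st_add xS) // quotient_mapM.
- by rewrite /commute -!quotient_mapM (st_commute xS).
- rewrite (lift u) (lift v) -residueM !quotient_rootE // -(st_comm xS _ _ ij jk ik).
  by rewrite !commgEl !conjgE !(quotient_mapM, quotient_mapV).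
Qed.

(** [S/M] satisfies the Steinberg relations over the finite ring [R/J], where [J]
    is the level ideal of [M]. *)
Lemma normal_finite_index :
  finitely_many_classes (fun a b => (b - a)%R \in level_ideal) ->
  finitely_many_classes (fun g h => g^-1 * h \in M).
Proof.
move=> fJ.
have finA : finite_type A.
  apply/finite_of_classes/classes_sub/(classes_preim (@lift_residue _ _ _) fJ) => u v /=.
  by move=> /(residueP level_ideal_two_sided); rewrite !lift_residueK.
have fQ : finite_type (quotient_group nM).
  apply: (steinberg_finite m3 quotient_root_steinberg finA) => q.
  have [g <-] := quotient_map_surj q; have := gen g.
  elim/generated_ind => [|h y IH [i [j [r [ij ->]]]]|h y IH [i [j [r [ij ->]]]]].
  - by rewrite quotient_map1 gpred1.
  - rewrite quotient_mapM gpredM // -quotient_rootE //.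
    by apply: mem_generated; do 3!eexists; split; first exact: ij.
  - rewrite quotient_mapM quotient_mapV gpredF // -quotient_rootE //.
    by apply: mem_generated; do 3!eexists; split; first exact: ij.
apply: classes_sub (classes_preim pr (classes_finite fQ)) => g h /=.
by move=> /quotient_mapP.
Qed.

End SteinbergQuotient.

(** * Length functions and torsion images *)

Lemma val_expg (G : groupType) (H : groupClosed G) (z : subgroup_type H) n :
  val (z ^+ n) = val z ^+ n.
Proof. by elim: n => [|n IHn]; rewrite ?expg0 ?val1 // !expgS valM IHn. Qed.

Section HeisenbergLength.
Variables (RR : realType) (Q : groupType) (l : Q -> RR).
Hypothesis lP : length_function l.

(** [n l(c) = l([a, b^n]) = l(a^-1 (a ^ (b^n))) <= 2 l(a)] for every [n], where
    the two factors commute because [a ^ (b^n) = a c^n]. *)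
Lemma length_heisenberg (a b : Q) : commute [~ a, b] a -> commute [~ a, b] b ->
  l [~ a, b] = 0%R.
Proof.
case: lP => l0 lX lJ lM; set c := [~ a, b] => ca cb.
have lXn g n : l (g ^+ n) = (n%:R * l g)%R by have := lX g (Posz n).
have lV g : l g^-1 = l g by have := lX g (Negz 0); rewrite /= expg1 mul1r.
have ab : a ^ b = a * c by rewrite /c commgEl mulVKg.
have conj_pow n : a ^ (b ^+ n) = a * c ^+ n.
  elim: n => [|n IHn]; first by rewrite conjg1 mulg1.
  rewrite expgSr conjgM IHn conjMg conjXg.
  have -> : c ^ b = c by rewrite conjgE cb mulKg.
  by rewrite ab -mulgA -expgS.
have bound n : (n%:R * l c <= l a + l a)%R.
  rewrite -lXn; have -> : c ^+ n = a^-1 * a ^ (b ^+ n) by rewrite conj_pow mulKg.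
  have lJb : l (a ^ (b ^+ n)) = l a.
    by rewrite conjgE mulgA -{2}[b ^+ n]invgK lJ.
  apply: (le_trans (lM _ _ _)); last by rewrite lV lJb.
  rewrite conj_pow; apply: commuteM; apply/commute_sym/commuteV => //.
  by apply/commute_sym/commuteX/commute_sym.
apply/eqP; rewrite eq_le l0 andbT leNgt; apply/negP=> lc0.
have [n nP] : exists n : nat, (l a + l a < n%:R * l c)%R.
  exists (Num.bound ((l a + l a) / l c)); rewrite -ltr_pdivrMr //.
  by apply: archi_boundP; rewrite divr_ge0 ?addr_ge0.
by have := le_lt_trans (bound n) nP; rewrite ltxx.
Qed.

End HeisenbergLength.

Section GroupHomomorphismOnSubgroup.
Variables (E : groupType) (D : groupClosed E) (Q : groupType) (phi : E -> Q).
Hypothesis phiM : forall g h, g \in D -> h \in D -> phi (g * h) = phi g * phi h.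

Lemma hom_on1 : phi 1 = 1.
Proof. by apply: (mulgI (phi 1)); rewrite -phiM ?gpred1 // !mulg1. Qed.

Lemma hom_onV g : g \in D -> phi g^-1 = (phi g)^-1.
Proof. by move=> Dg; apply/esym/mulg1_eq; rewrite -phiM ?gpredV // mulgV hom_on1. Qed.

Lemma hom_onX g n : g \in D -> phi (g ^+ n) = phi g ^+ n.
Proof.
move=> Dg; elim: n => [|n IHn]; first exact: hom_on1.
by rewrite !expgS phiM ?gpredXn // IHn.
Qed.

Lemma hom_onR g h : g \in D -> h \in D -> phi [~ g, h] = [~ phi g, phi h].
Proof.
by move=> Dg Dh; rewrite !commgEl !conjgE !phiM ?hom_onV ?gpredM ?gpredV.
Qed.

Definition hom_image : {pred Q} := fun q => `[< exists2 g, g \in D & phi g = q >].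

Fact hom_image_mul : mulg_closed hom_image.
Proof.
move=> _ _ /asboolP[g Dg <-] /asboolP[h Dh <-]; apply/asboolP.
by exists (g * h); rewrite ?gpredM ?phiM.
Qed.
Fact hom_image_one : 1 \in hom_image.
Proof. by apply/asboolP; exists 1; rewrite ?gpred1 ?hom_on1. Qed.
Fact hom_image_inv : invg_closed hom_image.
Proof.
by move=> _ /asboolP[g Dg <-]; apply/asboolP; exists g^-1; rewrite ?gpredV ?hom_onV.
Qed.
HB.instance Definition _ := isMulClosed.Build Q hom_image hom_image_mul.
HB.instance Definition _ := isMul1Closed.Build Q hom_image hom_image_one.
HB.instance Definition _ := isInvClosed.Build Q hom_image hom_image_inv.

Hypothesis finD : finitely_many_classes (fun g h => g^-1 * h \in D).

Lemma hom_image_finitely_generated (s : seq E) :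
  (forall g, g \in generated [set` s]) -> finitely_generated (subgroup_type hom_image).
Proof.
move=> sE; have [t [tD Dt]] := schreier sE finD.
apply: (@finitely_generated_subgroup _ _ [seq phi g | g <- t]).
  by move=> _ /mapP[g tg ->]; apply/asboolP; exists g => //; apply: tD.
move=> _ /asboolP[g Dg <-].
suff [] : g \in D /\ phi g \in generated [set` [seq phi g | g <- t]] by [].
have gens y : y \in t -> phi y \in generated [set` [seq phi g | g <- t]].
  by move=> ty; apply: mem_generated => /=; apply: map_f.
have := Dt _ Dg; elim/generated_ind => [|h y [Dh IH] /= ty|h y [Dh IH] /= ty].
- by rewrite gpred1 hom_on1 gpred1.
- by have Dy := tD _ ty; rewrite gpredM // phiM // gpredM // gens.
- have Dy := tD _ ty; rewrite gpredF // phiM ?gpredV // hom_onV //.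
  by rewrite gpredF // gens.
Qed.

Lemma power_in_finite_index g : exists n, g ^+ n.+1 \in D.
Proof.
have [F [c cD]] := finD.
have fF : finite_type F by exists (enum F) => f; rewrite mem_enum.
have [i [n e]] := sequence_repeats (fun i => c (g ^+ i)) fF.
by exists n; have := cD _ _ e; rewrite expgnDr mulKg.
Qed.

Variable RR : realType.
Hypothesis lengths : forall K : groupClosed Q, finitely_generated (subgroup_type K) ->
  exists l : subgroup_type K -> RR, length_function l /\ purely_positive l.
Hypothesis torsions : forall (K : groupClosed Q) (B : groupClosed (subgroup_type K)),
  finitely_generated (subgroup_type K) -> torsion (subgroup_type B) ->
  abelian_group (subgroup_type B) -> finitely_generated (subgroup_type B).

Variables (R : pzRingType) (m : nat) (x : 'I_m -> 'I_m -> R -> E) (s : seq E).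
Hypotheses (m3 : 2 < m) (xS : steinberg x) (sE : forall g, g \in generated [set` s]).

Lemma heisenberg_torsion a b : a \in D -> b \in D ->
  commute [~ a, b] a -> commute [~ a, b] b -> exists n, phi [~ a, b] ^+ n.+1 = 1.
Proof.
move=> Da Db ca cb; have fK := hom_image_finitely_generated sE.
have Kphi g : g \in D -> phi g \in hom_image by move=> Dg; apply/asboolP; exists g.
pose a' : subgroup_type hom_image := Sub (phi a) (Kphi _ Da).
pose b' : subgroup_type hom_image := Sub (phi b) (Kphi _ Db).
have Dc : [~ a, b] \in D by rewrite gpredR.
have ec : val [~ a', b'] = phi [~ a, b] by rewrite gmulfR hom_onR // !SubK.
have [l [lP lpos]] := lengths fK.
have com (d : subgroup_type hom_image) h : h \in D -> val d = phi h ->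
    commute [~ a, b] h -> commute [~ a', b'] d.
  move=> Dh ed cdh; apply: val_inj; rewrite valM [RHS]valM ec ed -!phiM //.
  by rewrite cdh.
have l0 : l [~ a', b'] = 0%R.
  by apply: (length_heisenberg lP); [apply: (com _ a) | apply: (com _ b)]; rewrite ?SubK.
apply: contrapT => no.
have /lpos : infinite_order [~ a', b'].
  move=> [//|n] _ /(congr1 val); rewrite val_expg ec val1 => e.
  by apply: no; exists n.
by rewrite l0 ltxx.
Qed.

Lemma root_power i j r n : i != j -> x i j r ^+ n = x i j (r *+ n)%R.
Proof.
move=> ij; elim: n => [|n IHn]; first by rewrite mulr0n (st_zero xS).
by rewrite expgS IHn -(st_add xS) // -mulrS.
Qed.

(** Powers of [x_ik(1)] and [x_kj(r)] in [D] have as commutator a power of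
    [x_ij(r)], which commutes with both of them. *)
Lemma root_torsion i j r : i != j -> x i j r \in D ->
  exists n, phi (x i j r) ^+ n.+1 = 1.
Proof.
move=> ij Dx; have [k [ki kj]] := third_index i j m3.
have ik : i != k by rewrite eq_sym.
have ji : j != i by rewrite eq_sym.
have jk : j != k by rewrite eq_sym.
have [n1 Da] := power_in_finite_index (x i k 1%R).
have [n2 Db] := power_in_finite_index (x k j r).
move: Da Db; rewrite !root_power // => Da Db.
have ec : [~ x i k (1 *+ n1.+1)%R, x k j (r *+ n2.+1)%R] = x i j r ^+ (n1.+1 * n2.+1).
  rewrite (st_comm xS _ _ ik kj ij) root_power //; congr (x i j _).
  by rewrite mulrnAl mul1r -mulrnA mulnC.
have [||n] := heisenberg_torsion Da Db.
- by rewrite ec root_power //; apply: (st_commute xS).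
- by rewrite ec root_power //; apply: (st_commute xS).
rewrite ec hom_onX // -expgnA => e; exists (n1.+1 * n2.+1 * n.+1).-1.
by rewrite prednK ?muln_gt0.
Qed.

Section RootImage.
Variables (i j : 'I_m).
Hypothesis ij : i != j.

Definition root_image : {pred subgroup_type hom_image} :=
  fun z => `[< exists r, x i j r \in D /\ phi (x i j r) = val z >].

Fact root_image_mul : mulg_closed root_image.
Proof.
move=> y z /asboolP[r [Dr er]] /asboolP[r' [Dr' er']]; apply/asboolP.
by exists (r + r')%R; rewrite (st_add xS) // gpredM // phiM // valM er er'.
Qed.
Fact root_image_one : 1 \in root_image.
Proof.
by apply/asboolP; exists 0%R; rewrite (st_zero xS) // gpred1 hom_on1 val1.
Qed.
Fact root_image_inv : invg_closed root_image.
Proof.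
move=> y /asboolP[r [Dr er]]; apply/asboolP.
by exists (- r)%R; rewrite (st_opp xS) // gpredV hom_onV // gmulfV er.
Qed.
HB.instance Definition _ := isMulClosed.Build _ root_image root_image_mul.
HB.instance Definition _ := isMul1Closed.Build _ root_image root_image_one.
HB.instance Definition _ := isInvClosed.Build _ root_image root_image_inv.

(** The image of a root subgroup is abelian and, by [root_torsion], torsion; the
    second hypothesis on [Q] makes it finitely generated, hence finite. *)
Lemma finite_root_image : exists t : seq Q,
  forall r, x i j r \in D -> phi (x i j r) \in t.
Proof.
have fK := hom_image_finitely_generated sE.
have tor : torsion (subgroup_type root_image).
  move=> z inf; have /asboolP[r [Dr er]] := valP z.
  have [n en] := root_torsion ij Dr; apply: (inf n.+1) => //.
  by do 2!apply: val_inj; rewrite !val_expg !val1 -er.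
have ab : abelian_group (subgroup_type root_image).
  move=> y z; have /asboolP[r [Dr er]] := valP y; have /asboolP[r' [Dr' er']] := valP z.
  do 2!apply: val_inj; rewrite !valM -er -er' -!phiM //.
  by rewrite -!(st_add xS) // addrC.
have [t tP] := finite_abelian_torsion (torsions fK tor ab) tor ab.
exists [seq val (val z) | z <- t] => r Dr.
have Kr : phi (x i j r) \in hom_image by apply/asboolP; exists (x i j r).
pose z : subgroup_type hom_image := Sub (phi (x i j r)) Kr.
have Bz : z \in root_image.
  by apply/asboolP; exists r; rewrite SubK.
apply/mapP; exists (Sub z Bz : subgroup_type root_image); first exact: tP.
by rewrite !SubK.
Qed.

Lemma root_kernel_finite_index : finitely_many_classes (fun r r' : R =>
  x i j (r' - r)%R \in D /\ phi (x i j (r' - r)%R) = 1).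
Proof.
have [t tP] := finite_root_image.
have fD : finitely_many_classes (fun r r' : R => x i j (r' - r)%R \in D).
  apply: classes_sub (classes_preim (x i j) finD) => r r'.
  by rewrite -(st_opp xS) // -(st_add xS) // addrC.
have [F [c [rep [cD rc]]]] := classes_representatives 0%R fD.
have fphi := classes_preim (fun r => phi (x i j (r - rep (c r))%R)) (classes_seq t).
have fc : finitely_many_classes (fun r r' => c r = c r') by exists F, c.
apply: classes_sub (classes_and fc fphi) => r r' [crr' e].
have Dr : x i j (r - rep (c r))%R \in D by apply/cD/rc.
have Dr' : x i j (r' - rep (c r))%R \in D by apply: cD; rewrite rc.
move: e; rewrite -crr' => /(_ (tP _ Dr) (tP _ Dr')) e.
have -> : (r' - r = - (r - rep (c r)) + (r' - rep (c r)))%R.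
  by rewrite opprB [RHS]addrC addrA subrK.
rewrite (st_add xS) // (st_opp xS) // gpredM ?gpredV // phiM ?gpredV // hom_onV //.
by rewrite e mulVg.
Qed.

End RootImage.
End GroupHomomorphismOnSubgroup.

Lemma steinberg_conj (R : pzRingType) (E : groupType) (m : nat)
    (x : 'I_m -> 'I_m -> R -> E) e :
  steinberg x -> steinberg (fun i j r => x i j r ^ e).
Proof.
move=> xS; split=> [i j a b ij|i j k l a b ij kl jk il|i j k a b ij jk ik].
- by rewrite (st_add xS) // conjMg.
- by rewrite /commute -!conjMg (st_commute xS).
- by rewrite -conjRg (st_comm xS).
Qed.

Section KernelFiniteIndex.
Variables (E : groupType) (D : groupClosed E) (Q : groupType) (phi : E -> Q).
Hypothesis phiM : forall g h, g \in D -> h \in D -> phi (g * h) = phi g * phi h.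
Hypothesis finD : finitely_many_classes (fun g h => g^-1 * h \in D).
Variable RR : realType.
Hypothesis lengths : forall K : groupClosed Q, finitely_generated (subgroup_type K) ->
  exists l : subgroup_type K -> RR, length_function l /\ purely_positive l.
Hypothesis torsions : forall (K : groupClosed Q) (B : groupClosed (subgroup_type K)),
  finitely_generated (subgroup_type K) -> torsion (subgroup_type B) ->
  abelian_group (subgroup_type B) -> finitely_generated (subgroup_type B).
Variables (R : pzRingType) (m : nat) (x : 'I_m -> 'I_m -> R -> E) (s : seq E).
Hypotheses (m3 : 2 < m) (xS : steinberg x) (sE : forall g, g \in generated [set` s]).
Hypothesis gen : forall g,
  g \in generated [set g | exists i j r, i != j /\ g = x i j r].

(** The largest normal subgroup of [E] on which [phi] is defined and trivial. *)
Definition kernel_core : {pred E} :=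
  fun g => `[< forall e, g ^ e \in D /\ phi (g ^ e) = 1 >].

Fact kernel_core_mul : mulg_closed kernel_core.
Proof.
move=> g h /asboolP Kg /asboolP Kh; apply/asboolP=> e.
have [[Dg pg] [Dh ph]] := (Kg e, Kh e).
by rewrite conjMg gpredM // phiM // pg ph mulg1.
Qed.
Fact kernel_core_one : 1 \in kernel_core.
Proof. by apply/asboolP=> e; rewrite conj1g gpred1 (hom_on1 phiM). Qed.
Fact kernel_core_inv : invg_closed kernel_core.
Proof.
move=> g /asboolP Kg; apply/asboolP=> e; have [Dg pg] := Kg e.
by rewrite conjVg gpredV (hom_onV phiM) // pg invg1.
Qed.
HB.instance Definition _ := isMulClosed.Build E kernel_core kernel_core_mul.
HB.instance Definition _ := isMul1Closed.Build E kernel_core kernel_core_one.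
HB.instance Definition _ := isInvClosed.Build E kernel_core kernel_core_inv.

Lemma kernel_core_normal : normal_subgroup kernel_core.
Proof.
move=> g h /asboolP Kg; apply/asboolP=> e.
have -> : h * g * h^-1 = g ^ h^-1 by rewrite conjgE invgK mulgA.
by rewrite -conjgM.
Qed.

(** Conjugating inside [D] does not affect triviality of [phi], so it suffices to
    treat one conjugate of each root subgroup for each of the finitely many
    cosets of [D]; each conjugate family satisfies the Steinberg relations. *)
Lemma kernel_core_level :
  finitely_many_classes (fun r r' : R => (r' - r)%R \in level_ideal x kernel_core).
Proof.
have [F [c [rep [cD rc]]]] := classes_representatives 1 finD.
have fam f (ij : 'I_m * 'I_m) : finitely_many_classes (fun r r' : R => ij.1 != ij.2 ->
    x ij.1 ij.2 (r' - r)%R ^ rep f \in D /\ phi (x ij.1 ij.2 (r' - r)%R ^ rep f) = 1).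
  have [e|ne] := eqVneq ij.1 ij.2; first by exists unit, (fun=> tt).
  have := root_kernel_finite_index phiM finD lengths torsions m3
    (steinberg_conj (rep f) xS) sE ne.
  by apply: classes_sub.
apply: classes_sub (classes_all (fun f => classes_all (fam f))) => r r' all_fam.
apply/asboolP=> i j ij; apply/asboolP=> e.
have [Dg pg] := all_fam (c e) (i, j) ij.
have De : (rep (c e))^-1 * e \in D by apply/cD/rc.
have -> : x i j (r' - r)%R ^ e = (x i j (r' - r)%R ^ rep (c e)) ^ ((rep (c e))^-1 * e).
  by rewrite -conjgM mulVKg.
move: Dg pg De; move: (_ ^ rep _) (_ * e) => /= g d Dg pg De.
rewrite gpredJ // conjgE !phiM ?gpredM ?gpredV // pg mul1g (hom_onV phiM) //.
by rewrite mulVg.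
Qed.

Lemma kernel_finite_index :
  finitely_many_classes (fun g h => g^-1 * h \in D /\ phi (g^-1 * h) = 1).
Proof.
have := normal_finite_index m3 xS gen kernel_core_normal kernel_core_level.
by apply: classes_sub => g h /asboolP/(_ 1); rewrite conjg1.
Qed.

End KernelFiniteIndex.

(** * Descent along the subnormal series *)

Lemma finite_index_classes (G : groupType) (H : groupClosed G) :
  finite_index H -> finitely_many_classes (fun g h => g^-1 * h \in H).
Proof.
move=> /finite_seqP[s sP]; have cs g : left_coset H g \in s.
  by have : [set` s]%classic (left_coset H g) by rewrite -sP; exists g.
apply: classes_sub (classes_preim (left_coset H) (classes_seq s)) => g h.
move=> /(_ (cs g) (cs h)) e.
have : left_coset H g h by rewrite e; exists 1; rewrite ?mulg1 //= gpred1.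
by move=> [y Hy <-]; rewrite mulKg.
Qed.

Lemma finite_range_of_classes (T : Type) (U : choiceType) (f : T -> U) :
  finitely_many_classes (fun y z => f y = f z) -> finite_set (range f).
Proof.
move=> fin; have [[t0]|no] := pselect (inhabited T); last first.
  rewrite (_ : range f = set0%classic) // -subset0 => y [t _ _].
  by case: no; exists.
have [F [c [r [cf rc]]]] := classes_representatives t0 fin.
apply: (@sub_finite_set _ _ [set` [seq f (r y) | y <- enum F]]%classic); last exact: finite_seq.
move=> _ [z _ <-]; apply/mapP; exists (c z); first by rewrite mem_enum.
by apply/esym/cf/rc.
Qed.

Section HomPreimage.
Variables (E : groupType) (D : groupClosed E) (Q : groupType) (phi : E -> Q).
Hypothesis phiM : forall g h, g \in D -> h \in D -> phi (g * h) = phi g * phi h.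
Variable N : groupClosed Q.

Definition hom_preimage : {pred E} := fun g => (g \in D) && (phi g \in N).

Fact hom_preimage_mul : mulg_closed hom_preimage.
Proof.
by move=> g h /andP[Dg Ng] /andP[Dh Nh]; apply/andP; rewrite phiM // !gpredM.
Qed.
Fact hom_preimage_one : 1 \in hom_preimage.
Proof. by apply/andP; rewrite (hom_on1 phiM) !gpred1. Qed.
Fact hom_preimage_inv : invg_closed hom_preimage.
Proof.
by move=> g /andP[Dg Ng]; apply/andP; rewrite (hom_onV phiM) // !gpredV.
Qed.
HB.instance Definition _ := isMulClosed.Build E hom_preimage hom_preimage_mul.
HB.instance Definition _ := isMul1Closed.Build E hom_preimage hom_preimage_one.
HB.instance Definition _ := isInvClosed.Build E hom_preimage hom_preimage_inv.

Lemma hom_preimage_finite_index :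
  finitely_many_classes (fun g h => g^-1 * h \in D) ->
  finitely_many_classes (fun q r => q^-1 * r \in N) ->
  finitely_many_classes (fun g h => g^-1 * h \in hom_preimage).
Proof.
move=> fD fN; have [F [c [rep [cD rc]]]] := classes_representatives 1 fD.
have fphi := classes_preim (fun g => phi ((rep (c g))^-1 * g)) fN.
have fc : finitely_many_classes (fun g h => c g = c h) by exists F, c.
apply: classes_sub (classes_and fc fphi) => g h [cgh].
have Dg : (rep (c g))^-1 * g \in D by apply/cD/rc.
have Dh : (rep (c g))^-1 * h \in D by apply: cD; rewrite rc.
rewrite -cgh -(hom_onV phiM) // -phiM ?gpredV // => Ngh.
have e : ((rep (c g))^-1 * g)^-1 * ((rep (c g))^-1 * h) = g^-1 * h.
  by rewrite invgM invgK -mulgA mulVKg.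
by apply/andP; rewrite -{1}e -e gpredM ?gpredV.
Qed.

Definition hom_preimage_closed : groupClosed E := hom_preimage.

End HomPreimage.

Section ExtendedHom.
Variables (E : groupType) (D : groupClosed E) (G : groupType).
Variable f : {multiplicative subgroup_type D -> G}.

(** Homomorphisms defined on a subgroup are replaced by functions on the whole
    group, multiplicative on the subgroup; shrinking the subgroup then needs no
    change of type. *)
Definition extend_hom (g : E) : G :=
  if insub g is Some z then f (z : subgroup_type D) else 1.

Lemma extend_homE (z : subgroup_type D) : extend_hom (val z) = f z.
Proof. by rewrite /extend_hom valK. Qed.

Lemma extend_homM g h : g \in D -> h \in D ->
  extend_hom (g * h) = extend_hom g * extend_hom h.
Proof.
move=> Dg Dh; pose y : subgroup_type D := Sub g Dg.
pose z : subgroup_type D := Sub h Dh.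
by rewrite -[g]/(val y) -[h]/(val z) -valM !extend_homE gmulfM.
Qed.

End ExtendedHom.

Section FactorHom.
Variables (E : groupType) (D : groupClosed E) (G : groupType) (phi : E -> G).
Hypothesis phiM : forall g h, g \in D -> h \in D -> phi (g * h) = phi g * phi h.
Variables (N K : groupClosed G) (nNK : normal_in N K).
Hypothesis phiK : forall g, g \in D -> phi g \in K.

Definition factor_hom (g : E) : factor_group nNK :=
  quotient_map (proj2 nNK) (insubd (1 : subgroup_type K) (phi g)).

Lemma factor_homM g h : g \in D -> h \in D ->
  factor_hom (g * h) = factor_hom g * factor_hom h.
Proof.
move=> Dg Dh; rewrite /factor_hom -quotient_mapM; congr quotient_map.
apply: val_inj; rewrite valM !insubdK ?phiM //; try exact: phiK.
by apply: gpredM; apply: phiK.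
Qed.

Lemma factor_hom1 g : g \in D -> factor_hom g = 1 -> phi g \in N.
Proof.
move=> Dg; rewrite -(quotient_map1 (proj2 nNK)) => /esym/quotient_mapP.
rewrite invg1 mul1g => inN; have : val (insubd (1 : subgroup_type K) (phi g)) \in N by [].
by rewrite insubdK //; apply: phiK.
Qed.

End FactorHom.

Theorem theorem0p6 (RR : realType) (G : groupType)
    (H : groupClosed G) (H_finite_index : finite_index H)
    (n : nat) (Hs : nat -> groupClosed G)
    (Hs_first : Hs 0 =i H) (Hs_last : forall x : G, (x \in Hs n) = (x == 1%g))
    (Hs_normal : forall i : nat, i < n -> normal_in (Hs i.+1) (Hs i))
    (length_hyp : forall (i : nat) (lt_in : i < n)
        (K : groupClosed (factor_group (Hs_normal i lt_in))),
      finitely_generated (subgroup_type K) ->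
      exists l : subgroup_type K -> RR,
        length_function l /\ purely_positive l)
    (torsion_hyp : forall (i : nat) (lt_in : i < n)
        (K : groupClosed (factor_group (Hs_normal i lt_in)))
        (A : groupClosed (subgroup_type K)),
      finitely_generated (subgroup_type K) ->
      torsion (subgroup_type A) -> abelian_group (subgroup_type A) ->
      finitely_generated (subgroup_type A))
    (R : pzRingType) (R_finitely_generated : finitely_generated_ring R)
    (m : nat) (m_ge3 : 3 <= m)
    (Gamma : groupClosed (elementary_group R m))
    (Gamma_finite_index : finite_index Gamma)
    (f : {multiplicative subgroup_type Gamma -> G}) :
  finite_set (range f).
Proof.
have [s sR] := R_finitely_generated.
have rS := root_steinberg R m.
have gen := @root_generated R m.
have few := few_roots_generate m_ge3 rS sR gen.
have fM := extend_homM f; set phi := extend_hom f in fM.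
suff chain k : k <= n -> exists D : groupClosed (elementary_group R m),
    [/\ finitely_many_classes (fun g h => g^-1 * h \in D), {subset D <= Gamma} &
        forall g, g \in D -> phi g \in Hs k].
  have [D [fD DGamma Dn]] := chain n (leqnn n).
  apply: finite_range_of_classes; apply: classes_sub (classes_preim val fD) => y z /= Dyz.
  have := Dn _ Dyz; rewrite Hs_last => /eqP e.
  have fz : phi (val z) = phi (val y) * phi ((val y)^-1 * val z).
    by rewrite -fM ?(valP y) ?DGamma // mulVKg.
  by move: fz; rewrite e mulg1 /phi !extend_homE => ->.
elim: k => [_|k IHk lt_kn].
  pose D : groupClosed _ := hom_preimage_closed fM (Hs 0).
  exists D; split=> [|g /andP[]//|g /andP[]//].
  apply: (hom_preimage_finite_index fM); first exact: finite_index_classes.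
  by apply: classes_sub (finite_index_classes H_finite_index) => y z; rewrite Hs_first.
have [D [fD DGamma Dk]] := IHk (ltnW lt_kn).
have phiM g h : g \in D -> h \in D -> phi (g * h) = phi g * phi h.
  by move=> /DGamma Dg /DGamma Dh; apply: fM.
have psiM := factor_homM phiM (Hs_normal k lt_kn) Dk.
have := kernel_finite_index psiM fD (length_hyp k lt_kn) (torsion_hyp k lt_kn)
  m_ge3 rS few gen.
pose D' : groupClosed _ := hom_preimage_closed phiM (Hs k.+1).
move=> fD'; exists D'; split=> [|g /andP[/DGamma]//|g /andP[]//].
apply: classes_sub fD' => g h [Dgh /(factor_hom1 Dk Dgh) Ngh].
exact/andP.
Qed.
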